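(* Let $(R,\mathfrak{m})$ be a Gorenstein local ring of dimension $d\geq 2$ and let $J=(z_1,\ldots,z_d)$ be an ideal generated by a regular sequence $z_1,\ldots,z_d$ contained in $\mathfrak{m}^s$, where $s$ is an integer $\geq 2$. For $k=1,2$ set $I_k=J\colon \mathfrak{m}^k$, and assume that $z_1,\ldots,z_d$ are among the minimal generators of $I_2$. Then the length of the first Koszul homology module of $I_2$ is \[ \lambda(H_1(I_2))=n\,\lambda(R/I_2)+\binom{n+1}{2}-\lambda(R/\mathfrak{m}^2), \] where $n=\lambda(\mathfrak{m}/\mathfrak{m}^2)$.
   Context: All rings are commutative and Noetherian. $\lambda(\cdot)$ denotes length of an $R$-module. For ideals $A,B$, $A\colon B=\{r\in R: rB\subseteq A\}$. ''$z_1,\ldots,z_d$ are among the minimal generators of $I$'' means that $z_1,\ldots,z_d$ form part of a minimal generating set of $I$. $H_1(I)$ denotes the first homology module of the Koszul complex over $R$ on a minimal generating set of $I$ (up to isomorphism it does not depend on the chosen minimal generating set). *)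

(* Defs.v *)
From HB Require Import structures.
From mathcomp Require Import all_boot all_algebra generic_quotient ring_quotient.
From mathcomp Require Import ring.
From mathcomp Require Import boolp classical_sets.

Set Implicit Arguments.
Unset Strict Implicit.
Unset Printing Implicit Defensive.

Import GRing.Theory.
Local Open Scope ring_scope.
Local Open Scope quotient_scope.

(* Predicates in MathComp are boolean; an arbitrary subset {x | P x} is turned *)
(* into one by the classical reflection `[< P x >] of boolp, so submodules and *)
(* ideals below are not restricted to decidable ones.                          *)

Record submodule (R : pzRingType) (V : lmodType R) := Submodule {
  submodule_pred :> {pred V};
  submodule_closed : submod_closed submodule_pred
}.

HB.instance Definition _ (R : pzRingType) (V : lmodType R) (N : submodule V) :=
  GRing.isSubmodClosed.Build R V (submodule_pred N) (submodule_closed N).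

Section Submodules.
Context {R : pzRingType} {V : lmodType R}.
Implicit Types N P : submodule V.

Definition sub_module N : Type := {x : V | x \in N}.

HB.instance Definition _ N := SubChoice.on (sub_module N).
HB.instance Definition _ N :=
  GRing.SubChoice_isSubLmodule.Build R V (submodule_pred N)
    (sub_module N) (submodule_closed N).

Definition quotient N : Type := Quotient.quot (submodule_pred N).

HB.instance Definition _ N := GRing.Zmodule.on (quotient N).
HB.instance Definition _ N := EqQuotient.on (quotient N).

Definition quotient_scale N (a : R) (x : quotient N) : quotient N :=
  \pi_(quotient N) (a *: repr x).

Lemma pi_quotient_scale N a (x : V) :
  quotient_scale a (\pi_(quotient N) x) = \pi_(quotient N) (a *: x).
Proof.
apply/eqP; rewrite -[_ == _]Quotient.idealrBE -scalerBr rpredZ //.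
by rewrite Quotient.idealrBE reprK.
Qed.

Lemma quotient_scaleA N a b (x : quotient N) :
  quotient_scale a (quotient_scale b x) = quotient_scale (a * b) x.
Proof.
elim/quotW: x => x.
by rewrite [quotient_scale b _]pi_quotient_scale !pi_quotient_scale scalerA.
Qed.

Lemma quotient_scale1 N : left_id 1 (@quotient_scale N).
Proof. by move=> x; rewrite -[x]reprK pi_quotient_scale scale1r. Qed.

Lemma pi_quotientD N (x y : V) :
  \pi_(quotient N) (x + y) = \pi_(quotient N) x + \pi_(quotient N) y.
Proof. exact: (Quotient.pi_add N). Qed.

Lemma quotient_scaleDr N : right_distributive (@quotient_scale N) +%R.
Proof.
move=> a x y; rewrite -[x]reprK -[y]reprK -pi_quotientD !pi_quotient_scale.
by rewrite scalerDr pi_quotientD.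
Qed.

Lemma quotient_scaleDl N (x : quotient N) :
  {morph (fun a => quotient_scale a x) : a b / a + b}.
Proof.
move=> a b; rewrite -[x]reprK !pi_quotient_scale.
by rewrite scalerDl pi_quotientD.
Qed.

HB.instance Definition _ N := GRing.Zmodule_isLmodule.Build R (quotient N)
  (@quotient_scaleA N) (@quotient_scale1 N) (@quotient_scaleDr N)
  (@quotient_scaleDl N).

Definition restrict_pred N P : {pred sub_module N} := fun x => val x \in P.

Lemma restrict_closed N P : submod_closed (@restrict_pred N P).
Proof.
split=> [|a x y]; first by rewrite -topredE /= /restrict_pred raddf0 rpred0.
rewrite -!topredE /= /restrict_pred => xP yP.
by rewrite linearP rpredD ?rpredZ.
Qed.

Definition restrict N P := Submodule (restrict_closed N P).

End Submodules.

(* N / (N :&: P), which is N / P when P is contained in N.                     *)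
Definition subquotient (R : pzRingType) (V : lmodType R) (N P : submodule V) :=
  quotient (restrict N P).

HB.instance Definition _ (R : pzRingType) (V : lmodType R) (N P : submodule V) :=
  GRing.Lmodule.on (subquotient N P).

Section Length.
Context {R : pzRingType}.
Implicit Type M : lmodType R.

Definition has_chain M (l : nat) : Prop :=
  exists N : nat -> submodule M, forall i, (i < l)%N ->
    {subset N i <= N i.+1} /\ ~ {subset N i.+1 <= N i}.

Definition is_length M : set nat :=
  [set l | has_chain M l /\ forall k, has_chain M k -> (k <= l)%N].

Definition finite_length M : Prop := exists l, is_length M l.

(* The supremum of the lengths of strict chains of submodules; the junk value  *)
(* is 0 when M does not have finite length.                                    *)
Definition length M : nat := xget 0%N (is_length M).

End Length.

Notation ideal R := (submodule R^o).

Section Ideals.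
Context {R : comNzRingType}.
Implicit Types (A B P : ideal R) (s t : seq R).

Lemma idealM A (a x : R) : x \in A -> a * x \in A.
Proof. by move=> xA; exact: (@rpredZ R R^o A a x). Qed.

Definition ideal_gen_pred s : {pred R^o} :=
  fun x => `[< exists c : 'I_(size s) -> R, x = \sum_i c i * s`_i >].

Lemma ideal_gen_closed s : submod_closed (ideal_gen_pred s).
Proof.
split=> [|a x y].
  by apply/asboolP; exists (fun=> 0); rewrite big1 // => i _; rewrite mul0r.
move=> /asboolP[c ->] /asboolP[c' ->]; apply/asboolP.
exists (fun i => a * c i + c' i); rewrite /GRing.scale /= mulr_sumr -big_split.
by apply: eq_bigr => i _; rewrite mulrDl mulrA.
Qed.

Definition ideal_gen s := Submodule (ideal_gen_closed s).

Definition ideal_mul_pred A B : {pred R^o} :=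
  fun x => `[< exists2 s : seq (R * R),
    {in s, forall p, p.1 \in A /\ p.2 \in B} & x = \sum_(p <- s) p.1 * p.2 >].

Lemma ideal_mul_closed A B : submod_closed (ideal_mul_pred A B).
Proof.
split=> [|a x y]; first by apply/asboolP; exists [::]; rewrite ?big_nil.
move=> /asboolP[s sAB ->] /asboolP[t tAB ->]; apply/asboolP.
exists ([seq (a * p.1, p.2) | p <- s] ++ t) => [p|].
  rewrite mem_cat => /orP[/mapP[q /sAB[qA qB] ->]|/tAB//].
  by split=> //=; exact: idealM.
rewrite big_cat big_map /GRing.scale /= mulr_sumr; congr (_ + _).
by apply: eq_bigr => q _; rewrite mulrA.
Qed.

Definition ideal_mul A B := Submodule (ideal_mul_closed A B).

Fixpoint ideal_exp A (k : nat) : ideal R :=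
  if k is k'.+1 then ideal_mul A (ideal_exp A k') else ideal_gen [:: 1].

Definition ideal_colon_pred A B : {pred R^o} :=
  fun r => `[< forall b, b \in B -> r * b \in A >].

Lemma ideal_colon_closed A B : submod_closed (ideal_colon_pred A B).
Proof.
split=> [|a x y]; first by apply/asboolP=> b _; rewrite mul0r rpred0.
move=> /asboolP xP /asboolP yP; apply/asboolP => b bB.
by rewrite mulrDl rpredD ?yP // -mulrA idealM ?xP.
Qed.

Definition ideal_colon A B := Submodule (ideal_colon_closed A B).

Definition maximal_ideal A : Prop :=
  1 \notin A /\
  forall B, 1 \notin B -> {subset A <= B} -> {subset B <= A}.

Definition prime_ideal P : Prop :=
  1 \notin P /\ prime_idealr_closed (P : {pred R}).

Definition minimal_generators A s : Prop :=
  ideal_gen s =i A /\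
  forall t, subseq t s -> ideal_gen t =i A -> t = s.

(* s_i is a nonzerodivisor on R / (s_0, ..., s_(i-1)), and R / (s) is nonzero. *)
Definition regular_sequence s : Prop :=
  1 \notin ideal_gen s /\
  forall i, (i < size s)%N ->
    forall x, s`_i * x \in ideal_gen (take i s) -> x \in ideal_gen (take i s).

End Ideals.

Section Rings.
Variable R : comNzRingType.

Definition noetherian : Prop :=
  forall A : ideal R, exists s : seq R, ideal_gen s =i A.

Definition local (m : ideal R) : Prop :=
  maximal_ideal m /\ forall A : ideal R, maximal_ideal A -> A =i m.

Definition has_prime_chain (l : nat) : Prop :=
  exists P : nat -> ideal R,
    (forall i, (i <= l)%N -> prime_ideal (P i)) /\
    forall i, (i < l)%N ->
      {subset P i <= P i.+1} /\ ~ {subset P i.+1 <= P i}.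

Definition krull_dim (d : nat) : Prop :=
  has_prime_chain d /\ forall l, has_prime_chain l -> (l <= d)%N.

Definition injective_module (E : lmodType R) : Prop :=
  forall (A B : lmodType R) (f : {linear A -> B}) (g : {linear A -> E}),
    injective f -> exists h : {linear B -> E}, forall x, h (f x) = g x.

(* An exact sequence 0 -> M -> E_0 -> ... -> E_n -> 0 with all E_i injective.  *)
Definition finite_injective_dimension (M : lmodType R) : Prop :=
  exists (n : nat) (E : nat -> lmodType R) (e : {linear M -> E 0%N})
         (d : forall i, {linear E i -> E i.+1}),
  [/\ forall i, injective_module (E i),
      forall i, (n < i)%N -> forall x : E i, x = 0,
      injective e,
      forall x, d 0%N x = 0 <-> exists y, x = e y &
      forall i x, d i.+1 x = 0 <-> exists y, x = d i y].

Definition gorenstein_local (m : ideal R) : Prop :=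
  [/\ noetherian, local m & finite_injective_dimension R^o].

End Rings.

(* The Koszul complex on a_0, ..., a_(r-1) is the exterior algebra of R^r; an  *)
(* element f is written \sum_S f S *: e_S, where S runs over the subsets of    *)
(* 'I_r and e_S is the wedge, in increasing order, of the e_i with i in S. The *)
(* differential is the R-linear map                                            *)
(*   e_S |-> \sum_(i in S) (-1) ^+ #|[set j in S | j < i]| *: a_i e_(S :\ i),  *)
(* so that e_T occurs in the image of f through the sets S = i |: T.           *)
Definition koszul (R : comNzRingType) (r : nat) := {ffun {set 'I_r} -> R^o}.

HB.instance Definition _ (R : comNzRingType) (r : nat) :=
  GRing.Lmodule.on (koszul R r).

Section Koszul.
Context {R : comNzRingType} {r : nat}.
Variable a : r.-tuple R.
Local Notation koszul := (koszul R r).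

Definition koszul_diff (f : koszul) : koszul :=
  [ffun T : {set 'I_r} => \sum_(i | i \notin T)
    (-1) ^+ #|[set j in T | (j < i)%N]| * tnth a i * f (i |: T)].

Lemma koszul_diff_linear : linear koszul_diff.
Proof.
move=> c f g; apply/ffunP => T; rewrite !ffunE /= /GRing.scale /=.
rewrite mulr_sumr -big_split; apply: eq_bigr => i _ /=.
by rewrite !ffunE /GRing.scale /= mulrDr; congr (_ + _); rewrite mulrCA.
Qed.

HB.instance Definition _ :=
  GRing.isLinear.Build R koszul koszul *:%R koszul_diff koszul_diff_linear.

Lemma koszul_diffK (f : koszul) : koszul_diff (koszul_diff f) = 0.
Proof.
apply/ffunP => T; rewrite !ffunE.
pose sg (i : 'I_r) (S : {set 'I_r}) : R := (-1) ^+ #|[set j in S | (j < i)%N]|.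
pose F i j := sg i T * tnth a i * (sg j (i |: T) * tnth a j * f (j |: (i |: T))).
have sgU (i j : 'I_r) : i \notin T -> sg j (i |: T) = (-1) ^+ (i < j)%N * sg j T.
  move=> iT; rewrite /sg; case: (boolP (i < j)%N) => ij.
    rewrite -exprD; congr (GRing.exp (-1) _).
    have -> : [set k in i |: T | (k < j)%N] = i |: [set k in T | (k < j)%N].
      by apply/setP => k; rewrite !inE; case: eqP => [->|].
    by rewrite cardsU1 !inE (negPf iT).
  rewrite mul1r; congr (GRing.exp (-1) _); apply: eq_card => k; rewrite !inE.
    by case: eqP => [->|//]; rewrite (negPf ij) (negPf iT).
have Fanti i j : i \notin T -> j \notin T -> (i < j)%N -> F i j = - F j i.
  move=> iT jT ij; rewrite /F !sgU // ij ltnNge (ltnW ij) /= expr0 expr1.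
  rewrite finset.setUCA; set u := f _; ring.
transitivity (\sum_(i | i \notin T) \sum_(j | (j \notin T) && (j != i)) F i j).
  apply: eq_bigr => i iT; rewrite ffunE mulr_sumr; apply: eq_bigl => j.
  by rewrite !inE negb_or andbC.
transitivity (\sum_(i | i \notin T) \sum_(j | (j \notin T) && (i < j)%N) F i j
  + \sum_(i | i \notin T) \sum_(j | (j \notin T) && (j < i)%N) F i j).
  rewrite -big_split; apply: eq_bigr => i iT /=.
  rewrite (bigID (fun j : 'I_r => (i < j)%N)) /=; congr (_ + _); apply: eq_bigl => j.
    by rewrite -andbA; congr (_ && _); rewrite -val_eqE /=; case: ltngtP.
  by rewrite -andbA; congr (_ && _); rewrite -val_eqE /=; case: ltngtP.
rewrite [X in _ + X](exchange_big_dep (fun j => j \notin T)) /=; last first.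
  by move=> i j _ /andP[].
rewrite -big_split big1 //= => i iT.
rewrite [X in _ + X](eq_bigl (fun j => (j \notin T) && (i < j)%N)); last first.
  by move=> j; rewrite iT.
rewrite -big_split big1 //= => j /andP[jT ij].
by rewrite (Fanti i j) // addNr.
Qed.

Definition koszul_deg_pred (p : nat) : {pred koszul} :=
  fun f => [forall S : {set 'I_r}, (f S != 0) ==> (#|S| == p)].

Lemma koszul_deg_closed p : submod_closed (koszul_deg_pred p).
Proof.
have degP (f : koszul) : reflect (forall S : {set 'I_r}, #|S| != p -> f S = 0)
    (f \in koszul_deg_pred p).
  apply: (iffP forallP) => H S; last first.
    by apply/implyP; apply: contraNT => /H ->.
  by move=> Sp; apply/eqP; apply: contraNT Sp; exact/implyP.
split=> [|c f g /degP fp /degP gp]; first by apply/degP => S _; rewrite ffunE.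
by apply/degP => S Sp; rewrite !ffunE fp ?gp // scaler0 addr0.
Qed.

Definition koszul_deg p := Submodule (koszul_deg_closed p).

Definition koszul_cycles_pred (p : nat) : {pred koszul} :=
  fun f => (f \in koszul_deg p) && (koszul_diff f == 0).

Lemma koszul_cycles_closed p : submod_closed (koszul_cycles_pred p).
Proof.
split=> [|c f g /andP[fp /eqP df] /andP[gp /eqP dg]].
  by apply/andP; rewrite rpred0 linear0.
apply/andP; split; first by rewrite rpredD ?rpredZ.
by rewrite linearP /= df dg scaler0 addr0.
Qed.

Definition koszul_cycles p := Submodule (koszul_cycles_closed p).

Definition koszul_boundaries_pred (p : nat) : {pred koszul} :=
  fun f => `[< exists2 g, g \in koszul_deg p.+1 & f = koszul_diff g >].

Lemma koszul_boundaries_closed p : submod_closed (koszul_boundaries_pred p).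
Proof.
split=> [|c f g /asboolP[f' fp ->] /asboolP[g' gp ->]]; apply/asboolP.
  by exists 0; rewrite ?rpred0 ?linear0.
by exists (c *: f' + g'); rewrite ?rpredD ?rpredZ // linearP.
Qed.

Definition koszul_boundaries p := Submodule (koszul_boundaries_closed p).

Definition koszul_homology (p : nat) : lmodType R :=
  subquotient (koszul_cycles p) (koszul_boundaries p).

End Koszul.

(* Main.v *)
Require Import Defs.
From mathcomp Require Import all_boot all_algebra.
From HB Require Import structures.
From mathcomp Require Import generic_quotient ring zify.
From mathcomp Require Import boolp classical_sets.

(* Write A = R/J. The bounded injective resolution E of R gives, by induction  *)
(* on the regular sequence, a complex of elements of E killed by J whose only  *)
(* cohomology is A in degree d; its boundaries in degree d split off, and a    *)
(* socle argument going down from the top degree shows that its cycles in      *)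
(* degree d extend maps from ideals. So A is self-injective, with socle (u).   *)
(* If x_1, ..., x_n is a minimal generating set of m, extending the            *)
(* coordinates m/m^2 -> k = (u) to A yields w_1, ..., w_n with                 *)
(* x_i w_j = delta_ij u in A, and (w_1, ..., w_n) = 0 :_A m^2 = I_2/J.         *)
(* Since z is regular and part of a minimal generating set, H_1(I_2) is        *)
(* H_1(w; A) = Z/B with Z the kernel of w : A^n -> A, of length                *)
(* n l(A) - (n+1), and B spanned by the w_i e_j - w_j e_i. As n >= 2, mB is    *)
(* u A^n, of length n, and B/mB has dimension C(n,2). Hence                    *)
(* l(H_1) = n l(A) - (n+1) - C(n+1,2) with l(A) = l(R/I_2) + n + 1.            *)

Set Implicit Arguments.
Unset Strict Implicit.
Unset Printing Implicit Defensive.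

Import GRing.Theory.
Local Open Scope ring_scope.
Local Open Scope quotient_scope.

(** * Lengths of intervals of submodules *)

(** Put [A = R / J] and let [U / J] be the socle of [A], where [U = J + R u]. The ring [A] is
    injective over itself ([gorenstein_self_injective]): passing to the elements killed by one more
    [z_i] shifts the cohomology of an injective resolution of [R] by one degree
    ([cohomology_regular]), and from degree [d] on the cycles satisfy Baer's criterion over [A]
    ([cycle_baer]). All primes over [J] contain [m] ([prime_over_parameters]), so [A] has finite
    length and every nonzero quotient of it has a socle.

    Self-injectivity yields generators [w_j] of [I_2 / J] dual to minimal generators [x_i] of [m]
    ([dual_basis_exists]). Any minimal generating set of [I_2] may be replaced by [z, w]
    ([gens_change], [ilen_change_gens]), and then [z] may be divided out
    ([ilen_koszul_mod_regular]), which leaves syzygies of [w] over [A] modulo trivial ones. With [n]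
    the number of the [x_i], [ilen_koszul_syz] counts along [J^n], [U^n], trivial syzygies,
    syzygies, [R^n] (powers being direct sums): the steps are [n], ['C(n, 2)], the unknown length
    and [n + 1], the total is [n] times the length of [A]. Since the length of [R / m^2] is [n + 1],
    the formula follows. *)

Section Chains.
Context {R : pzRingType}.
Implicit Types V W : lmodType R.

Definition lin_closed V (P : V -> Prop) :=
  P 0 /\ forall a x y, P x -> P y -> P (a *: x + y).

Definition prop_pred V (P : V -> Prop) : {pred V} := fun x => `[< P x >].

Lemma prop_pred_closed V (P : V -> Prop) :
  lin_closed P -> submod_closed (prop_pred P).
Proof.
move=> [P0 PD]; split; first exact/asboolP.
by move=> a x y /asboolP xP /asboolP yP; apply/asboolP/PD.
Qed.

Definition propsub V (P : V -> Prop) (PC : lin_closed P) :=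
  Submodule (prop_pred_closed PC).

Lemma propsubP V (P : V -> Prop) (PC : lin_closed P) x :
  x \in propsub PC <-> P x.
Proof. by split=> /asboolP. Qed.

Lemma top_closed V : lin_closed (fun _ : V => True). Proof. by []. Qed.
Definition top_sub V := propsub (@top_closed V).
Lemma in_top V x : x \in top_sub V. Proof. exact/propsubP. Qed.

Lemma zero_closed V : lin_closed (fun x : V => x = 0).
Proof. by split=> // a x y -> ->; rewrite scaler0 addr0. Qed.
Definition zero_sub V := propsub (@zero_closed V).

Lemma add_sub_closed V (N P : submodule V) :
  lin_closed (fun x => exists2 y, y \in N & x - y \in P).
Proof.
split=> [|a x x' [y yN xy] [y' y'N xy']].
  by exists 0; rewrite ?subr0 rpred0.
exists (a *: y + y'); first by rewrite rpredD ?rpredZ.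
by rewrite opprD addrACA -scalerBr rpredD ?rpredZ.
Qed.
Definition add_sub V (N P : submodule V) := propsub (@add_sub_closed V N P).

Lemma cap_sub_closed V (N P : submodule V) : lin_closed (fun x => x \in N /\ x \in P).
Proof.
by split=> [|a x y [? ?] [? ?]]; split; rewrite ?rpred0 // rpredD // rpredZ.
Qed.
Definition cap_sub V (N P : submodule V) := propsub (@cap_sub_closed V N P).

Definition ichain V (P N : submodule V) (l : nat) := exists C : nat -> submodule V,
  (forall i, (i <= l)%N -> {subset P <= C i} /\ {subset C i <= N}) /\
  (forall i, (i < l)%N -> {subset C i <= C i.+1} /\ ~ {subset C i.+1 <= C i}).

(** The length of [N / P], expressed inside [V] so that no quotient has to be formed; as a relation
    it also asserts finiteness. *)
Definition ilen V (P N : submodule V) (l : nat) :=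
  ichain P N l /\ forall k, ichain P N k -> (k <= l)%N.

Lemma ilen_uniq V (P N : submodule V) k l : ilen P N k -> ilen P N l -> k = l.
Proof. by move=> [ck bk] [cl bl]; apply/eqP; rewrite eqn_leq bk ?bl. Qed.

Lemma ichain0 V (P N : submodule V) : {subset P <= N} -> ichain P N 0.
Proof. by move=> PN; exists (fun=> P); split=> // i _; split=> x // /PN. Qed.

Lemma ichain_sub V (P P' N N' : submodule V) k : {subset P' <= P} ->
  {subset N <= N'} -> ichain P N k -> ichain P' N' k.
Proof.
move=> PP NN [C [CB CS]]; exists C; split=> // i /CB[PC CN].
by split=> x xP; [exact: PC (PP _ xP)|exact: NN (CN _ xP)].
Qed.

Lemma ichainS V (P N N' : submodule V) k : {subset P <= N} ->
  {subset N <= N'} -> ~ {subset N' <= N} ->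
  ichain P N k -> ichain P N' k.+1.
Proof.
move=> PN NN NNN [C [CB CS]].
exists (fun i => if (i <= k)%N then C i else N'); split=> i ik.
  case: leqP => [/CB[PC CN]|_]; split=> // x; first by move=> /CN /NN.
  by move=> /PN /NN.
case: (leqP i k) => [_|ki]; last by move: ik; rewrite ltnS leqNgt ki.
move: ik; rewrite ltnS leq_eqVlt => /orP[/eqP->|ik]; last by rewrite ik; exact: CS.
rewrite ltnn; have [_ CN] := CB _ (leqnn k); split=> [x /CN /NN //|NC].
by apply: NNN => x /NC /CN.
Qed.

(* Modular law: a strict step of a chain is strict after intersecting with Q   *)
(* or after adding Q.                                                          *)
Lemma ichain_split V (P Q N : submodule V) k : {subset P <= Q} ->
  {subset Q <= N} -> ichain P N k ->
  exists k1 k2, [/\ ichain P Q k1, ichain Q N k2 & (k <= k1 + k2)%N].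
Proof.
move=> PQ QN [C [CB CS]].
suff /(_ k (leqnn k))[k1 [k2 [c1 c2 le]]] : forall i, (i <= k)%N -> exists k1 k2,
  [/\ ichain P (cap_sub (C i) Q) k1, ichain Q (add_sub (C i) Q) k2 & (i <= k1 + k2)%N].
  exists k1, k2; split=> //.
    by apply: ichain_sub c1 => // x /propsubP[].
  apply: ichain_sub c2 => // x /propsubP[y yC xyQ].
  rewrite -(subrK y x) rpredD //; first exact: QN.
  exact: (CB k (leqnn k)).2 _ yC.
have Pcap i : (i <= k)%N -> {subset P <= cap_sub (C i) Q}.
  by move=> ik x xP; apply/propsubP; split; [exact: (CB i ik).1 _ xP|exact: PQ].
have Qadd i : {subset Q <= add_sub (C i) Q}.
  by move=> x xQ; apply/propsubP; exists 0; rewrite ?subr0 ?rpred0.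
elim=> [|i IH] ik.
  by exists 0%N, 0%N; split=> //; apply: ichain0 => //; exact: Pcap.
have [k1 [k2 [c1 c2 le]]] := IH (ltnW ik); have [Ci nCi] := CS _ ik.
have sub1 : {subset cap_sub (C i) Q <= cap_sub (C i.+1) Q}.
  by move=> x /propsubP[/Ci ? ?]; apply/propsubP.
have sub2 : {subset add_sub (C i) Q <= add_sub (C i.+1) Q}.
  by move=> x /propsubP[y /Ci ? ?]; apply/propsubP; exists y.
have [sub1'|nsub1] := pselect {subset cap_sub (C i.+1) Q <= cap_sub (C i) Q};
  last first.
  exists k1.+1, k2; split=> //; last exact: ichain_sub c2.
  by apply: ichainS c1 => //; apply: Pcap; exact: ltnW.
exists k1, k2.+1; split; first exact: ichain_sub c1.
  apply: ichainS c2 => // sub2'; apply: nCi => x xC.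
  have /sub2'/propsubP[c cC xcQ] : x \in add_sub (C i.+1) Q.
    by apply/propsubP; exists x; rewrite ?subrr ?rpred0.
  have /sub1'/propsubP[xc _] : x - c \in cap_sub (C i.+1) Q.
    by apply/propsubP; rewrite rpredB //; exact: Ci.
  by rewrite -(subrK c x) rpredD.
by rewrite addnS ltnS.
Qed.

Lemma ichain_cat V (P Q N : submodule V) k l : {subset P <= Q} -> {subset Q <= N} ->
  ichain P Q k -> ichain Q N l -> ichain P N (k + l).
Proof.
move=> PQ QN ck [C [CB CS]].
suff H i : (i <= l)%N -> ichain P (C i) (k + i).
  by apply: ichain_sub (H l (leqnn l)) => //; have [] := CB l (leqnn l).
elim: i => [|i IH] il.
  by rewrite addn0; apply: ichain_sub ck => //; have [] := CB 0%N isT.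
rewrite addnS; have [Ci nCi] := CS _ il; apply: (@ichainS _ _ (C i)) => //.
  by have [QC _] := CB i (ltnW il); move=> x /PQ /QC.
exact/IH/ltnW.
Qed.

(** Concatenating chains gives the lower bound, splitting a chain at [Q] the upper one. *)
Lemma ilen_add V (P Q N : submodule V) k l : {subset P <= Q} -> {subset Q <= N} ->
  ilen P Q k -> ilen Q N l -> ilen P N (k + l).
Proof.
move=> PQ QN [ck bk] [cl bl]; split; first exact: ichain_cat ck cl.
move=> i /(ichain_split PQ QN)[k1 [k2 [/bk le1 /bl le2 /leq_trans]]]; apply.
exact: leq_add.
Qed.

Lemma ilen_bounded V (P N : submodule V) b : {subset P <= N} ->
  (forall k, ichain P N k -> (k <= b)%N) -> exists l, ilen P N l.
Proof.
move=> PN bd.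
have ex : exists i, `[< ichain P N i >] by exists 0%N; apply/asboolP/ichain0.
have bd' i : `[< ichain P N i >] -> (i <= b)%N by move/asboolP/bd.
case: (ex_maxnP ex bd') => l /asboolP cl ml; exists l; split=> // k ck.
exact/ml/asboolP.
Qed.

Lemma ilen_sub V (P P' N' N : submodule V) l : {subset P <= P'} ->
  {subset P' <= N'} -> {subset N' <= N} -> ilen P N l -> exists l', ilen P' N' l'.
Proof.
move=> PP PN NN [_ bl]; apply: (ilen_bounded (b := l)) => // k ck.
by apply: bl; exact: ichain_sub ck.
Qed.

Lemma ilen0 V (P N : submodule V) : {subset P <= N} -> {subset N <= P} -> ilen P N 0.
Proof.
move=> PN NP; split=> [|[//|k] [C [CB CS]]]; first exact: ichain0.
case: (CS 0%N) => // _ []; have [_ CN] := CB 1%N isT; have [PC _] := CB 0%N isT.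
by move=> x /CN /NP /PC.
Qed.

(** The hypotheses say that [f] induces an isomorphism of [N / P] onto [N' / P']; chains are carried
    over by [f (C i) + P'] and back by preimages in [N]. *)
Lemma ilen_map V W (f : V -> W) (P N : submodule V) (P' N' : submodule W) l :
  linear f -> {subset P <= N} -> {subset P' <= N'} ->
  {in N, forall x, f x \in N'} ->
  {in N', forall y, exists2 x, x \in N & f x - y \in P'} ->
  {in N, forall x, f x \in P' = (x \in P)} ->
  ilen P N l <-> ilen P' N' l.
Proof.
move=> flin PN PN' fN fsurj fP.
have f0 : f 0 = 0 by have := flin (-1) 0 0; rewrite scaleN1r oppr0 addr0 scaleN1r addNr.
have fB x y : f (x - y) = f x - f y.
  by have := flin (-1) y x; rewrite !scaleN1r ![- _ + _]addrC.
suff ce k : ichain P N k <-> ichain P' N' k.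
  by split=> -[/ce c b]; split=> // j /ce; exact: b.
split=> -[C [CB CS]].
  have im_closed i : lin_closed (fun y => exists2 x, x \in C i & f x - y \in P').
    split=> [|a y y' [x xC xy] [x' x'C xy']].
      by exists 0; rewrite ?f0 ?subr0 rpred0.
    exists (a *: x + x'); first by rewrite rpredD ?rpredZ.
    by rewrite flin opprD addrACA -scalerBr rpredD ?rpredZ.
  exists (fun i => propsub (im_closed i)); split=> i ik.
    have [PC CN] := CB i ik; split=> y; last move=> /propsubP[x xC xy].
      move=> yP; apply/propsubP; exists 0; first by rewrite rpred0.
      by rewrite f0 sub0r rpredN.
    by rewrite -(subKr (f x) y) rpredB //; [apply/fN/CN|apply: PN'].
  have [sub nsub] := CS i ik; split=> [y /propsubP[x /sub xC xy]|H].
    by apply/propsubP; exists x.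
  have [PC CN] := CB i (ltnW ik); have [PC1 CN1] := CB i.+1 ik.
  apply: nsub => x xC.
  have /H/propsubP[x' x'C] : f x \in propsub (im_closed i.+1).
    by apply/propsubP; exists x; rewrite ?subrr ?rpred0.
  rewrite -fB fP; last by apply: rpredB; [apply: CN|apply: CN1].
  by move=> /PC xx; rewrite -(subKr x' x) rpredB.
have pre_closed i : lin_closed (fun x => x \in N /\ f x \in C i).
  split=> [|a x y [xN xC] [yN yC]]; first by rewrite f0 !rpred0.
  by rewrite flin !rpredD ?rpredZ.
exists (fun i => propsub (pre_closed i)); split=> i ik.
  have [PC CN] := CB i ik; split=> x; last by move=> /propsubP[].
  by move=> xP; apply/propsubP; split; [apply: PN|apply: PC; rewrite fP ?PN].
have [sub nsub] := CS i ik; split=> [x /propsubP[xN /sub xC]|H].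
  exact/propsubP.
have [PC CN] := CB i (ltnW ik); have [PC1 CN1] := CB i.+1 ik.
apply: nsub => y yC; have [x xN xy] := fsurj y (CN1 _ yC).
have /H/propsubP[_ fx] : x \in propsub (pre_closed i.+1).
  apply/propsubP; split=> //; rewrite -(subrK y (f x)) rpredD //; exact: PC1.
by rewrite -(subKr (f x) y) rpredB //; exact: PC.
Qed.

Lemma ilen_push V W (f : V -> W) (P N : submodule V) (P' N' : submodule W) l :
  linear f -> {subset P <= N} -> {subset P' <= N'} ->
  {in N, forall x, f x \in N'} ->
  {in N', forall y, exists2 x, x \in N & f x - y \in P'} ->
  {in N, forall x, f x \in P' = (x \in P)} ->
  ilen P N l -> ilen P' N' l.
Proof. by move=> fl PN PN' fN fs fP; have [] := ilen_map l fl PN PN' fN fs fP. Qed.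

Lemma ilen_pull V W (f : V -> W) (P N : submodule V) (P' N' : submodule W) l :
  linear f -> {subset P <= N} -> {subset P' <= N'} ->
  {in N, forall x, f x \in N'} ->
  {in N', forall y, exists2 x, x \in N & f x - y \in P'} ->
  {in N, forall x, f x \in P' = (x \in P)} ->
  ilen P' N' l -> ilen P N l.
Proof. by move=> fl PN PN' fN fs fP; have [] := ilen_map l fl PN PN' fN fs fP. Qed.

Lemma is_lengthE (M : lmodType R) l :
  is_length M l <-> ilen (zero_sub M) (top_sub M) l.
Proof.
suff ce k : has_chain M k <-> ichain (zero_sub M) (top_sub M) k.
  by split=> -[/ce c b]; split=> // j /ce; exact: b.
split=> [[C CS]|[C [_ CS]]]; exists C => //; split=> // i _; split=> x //.
  by move=> /propsubP ->; rewrite rpred0.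
by move=> _; exact: in_top.
Qed.

Lemma in_quotient V (P : submodule V) (x y : V) :
  (\pi_(quotient P) x == \pi_(quotient P) y) = (x - y \in P).
Proof. exact/esym/Quotient.idealrBE. Qed.

Lemma pi_linear V (P : submodule V) : linear (\pi_(quotient P) : V -> quotient P).
Proof. by move=> a x y; rewrite pi_quotientD -pi_quotient_scale. Qed.

Lemma is_length_quotient V (P : submodule V) l :
  is_length (quotient P) l <-> ilen P (top_sub V) l.
Proof.
have pi0 : \pi_(quotient P) 0 = 0 :> quotient P.
  by have := @pi_linear V P (-1) 0 0; rewrite scaleN1r oppr0 addr0 scaleN1r addNr.
apply: (iff_trans (is_lengthE _ _)); apply: iff_sym.
apply: (ilen_map _ (@pi_linear V P)) => [x _|x _|x _|y _|x _]; try exact: in_top.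
  elim/quotW: y => y; exists y; first exact: in_top.
  by rewrite subrr rpred0.
apply/idP/idP => [/propsubP/eqP|xP].
  by rewrite -pi0 in_quotient subr0.
by apply/propsubP/eqP; rewrite -pi0 in_quotient subr0.
Qed.

Lemma is_length_subquotient V (N P : submodule V) l : {subset P <= N} ->
  is_length (subquotient N P) l <-> ilen P N l.
Proof.
move=> PN; apply: (iff_trans (is_length_quotient _ _)).
apply: (ilen_map _ (f := val)) => [a x y|x _|//|x _|y yN|x _]; try exact: in_top.
- exact: linearP.
- exact: valP.
- exists (Sub y yN); first exact: in_top.
  by rewrite SubK subrr rpred0.
- by [].
Qed.

Lemma lengthE (M : lmodType R) l : is_length M l -> length M = l.
Proof.
move=> Ml; apply: ilen_uniq (iffLR (is_lengthE _ _) _) (iffLR (is_lengthE _ _) Ml).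
by rewrite /length; apply: xgetPex; exists l.
Qed.

End Chains.

(** * Free modules, ideals and primes *)

Section FreeLengths.
Context {R : comNzRingType}.

Lemma ffun_sub_closed (T : finType) (P : ideal R) :
  lin_closed (fun q : {ffun T -> R^o} => forall t, q t \in P).
Proof.
by split=> [t|a x y xP yP t]; rewrite !ffunE ?rpred0 // rpredD ?rpredZ.
Qed.
Definition ffun_sub (T : finType) (P : ideal R) := propsub (@ffun_sub_closed T P).

(** Filter by [M i], the functions whose coordinates of rank at least [i] lie in [P]; each step is a
    copy of [R / P], read off at one coordinate. *)
Lemma ilen_ffun (T : finType) (P : ideal R) l :
  ilen P (top_sub R^o) l -> ilen (ffun_sub T P) (top_sub {ffun T -> R^o}) (#|T| * l).
Proof.
move=> Pl.
have Mc i : lin_closed (fun q : {ffun T -> R^o} =>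
    forall t, (i <= enum_rank t)%N -> q t \in P).
  split=> [t _|a x y xP yP t it]; rewrite !ffunE ?rpred0 //.
  by rewrite rpredD ?rpredZ ?xP ?yP.
pose M i := propsub (Mc i).
have MP i j : (i <= j)%N -> {subset M i <= M j}.
  move=> ij q /propsubP qi; apply/propsubP => t jt.
  exact/qi/(leq_trans ij jt).
suff H i : (i <= #|T|)%N -> ilen (M 0%N) (M i) (i * l).
  have := H _ (leqnn _); apply: (ilen_push (f := id)) => //.
  - exact: MP.
  - by move=> q _; exact: in_top.
  - by move=> q _; exact: in_top.
  - move=> q _; exists q; last by rewrite subrr rpred0.
    by apply/propsubP => t; rewrite leqNgt ltn_ord.
  - move=> q _; apply/idP/idP => /propsubP H'; apply/propsubP => t; last exact: H'.
    by move=> _; exact: H'.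
elim: i => [|i IH] iT; first by rewrite mul0n; apply: ilen0.
rewrite mulSn addnC; apply: (@ilen_add _ _ _ (M i)); try exact: MP.
  exact/IH/ltnW.
pose t0 := enum_val (Ordinal iT).
refine (ilen_pull (f := fun q : {ffun T -> R^o} => q t0) _ _ _ _ _ _ Pl) => //.
- by move=> a x y; rewrite !ffunE.
- exact: MP.
- by move=> x _; exact: in_top.
- by move=> x _; exact: in_top.
- move=> y _; exists [ffun t => if t == t0 then y else 0].
    apply/propsubP => t it; rewrite ffunE; case: eqP => [tt|_]; last exact: rpred0.
    by move: it; rewrite tt enum_valK ltnn.
  by rewrite ffunE eqxx subrr rpred0.
- move=> q /propsubP qi; apply/idP/idP => [qt|/propsubP]; last first.
    by apply; rewrite enum_valK.
  apply/propsubP => t; rewrite leq_eqVlt => /orP[/eqP it|/qi//].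
  suff -> : t = t0 by [].
  by apply: enum_rank_inj; rewrite enum_valK; apply: val_inj.
Qed.

(** Here [N / P] is a vector space over [R / m] with basis the classes of the [x t], so its length
    is its dimension. *)
Lemma ilen_span (m : ideal R) (V : lmodType R) (T : finType) (x : T -> V)
    (P N : submodule V) : ilen m (top_sub R^o) 1 -> {subset P <= N} ->
  (forall t, x t \in N) -> (forall a t, a \in m -> a *: x t \in P) ->
  (forall y, y \in N -> exists c : T -> R, y - \sum_t c t *: x t \in P) ->
  (forall c : T -> R, \sum_t c t *: x t \in P -> forall t, c t \in m) ->
  ilen P N #|T|.
Proof.
move=> m1 PN xN mx gen ind; have := ilen_ffun T m1; rewrite muln1.
apply: (ilen_push (f := fun c : {ffun T -> R^o} =>
   \sum_t (c t : R) *: x t)) => //.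
- move=> a c c'; rewrite scaler_sumr -big_split; apply: eq_bigr => t _ /=.
  by rewrite !ffunE scalerDl scalerA.
- by move=> c _; exact: in_top.
- by move=> c _; apply: rpred_sum => t _; apply: rpredZ.
- move=> y /gen[c cP]; exists [ffun t => c t]; first exact: in_top.
  rewrite -opprB rpredN; under eq_bigr do rewrite ffunE; exact: cP.
- move=> c _; apply/idP/idP => [/ind cm|/propsubP cm]; first exact/propsubP.
  by apply: rpred_sum => t _; apply: mx.
Qed.

Lemma ilen_maximal (m : ideal R) : maximal_ideal m -> ilen m (top_sub R^o) 1.
Proof.
move=> [m1 mmax]; split.
  apply: (@ichainS _ _ _ m) => // [x _|H|]; first exact: in_top.
    by move: m1; rewrite H //; exact: in_top.
  exact: ichain0.
move=> k [C [CB CS]]; rewrite leqNgt; apply/negP => k1.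
have [sub0 nsub0] := CS 0%N (ltnW k1); have [sub1 nsub1] := CS 1%N k1.
have [mC0 _] := CB 0%N isT; have [mC1 _] := CB 1%N (ltnW k1).
have [C1|C1] := boolP (1 \in C 1%N).
  by apply: nsub1 => x _; rewrite -[x]mulr1; exact: idealM.
by apply: nsub0 => x /(mmax _ C1 mC1) /mC0.
Qed.

End FreeLengths.

Section Ideals.
Context {R : comNzRingType}.
Implicit Types (A B P Q m : ideal R) (s t : seq R).

Lemma ideal0 A : 0 \in A. Proof. exact: (@rpred0 R^o). Qed.

Lemma idealD A (x y : R) : x \in A -> y \in A -> x + y \in A.
Proof. exact: (@rpredD R^o). Qed.

Lemma idealB A (x y : R) : x \in A -> y \in A -> x - y \in A.
Proof. exact: (@rpredB R^o). Qed.

Lemma idealN A (x : R) : x \in A -> - x \in A.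
Proof. by move=> xA; rewrite -sub0r idealB ?ideal0. Qed.

Lemma idealMC A (a x : R) : x \in A -> x * a \in A.
Proof. by rewrite mulrC; exact: idealM. Qed.

Lemma ideal_sum A (T : finType) (D : pred T) (F : T -> R) :
  (forall i, D i -> F i \in A) -> \sum_(i | D i) F i \in A.
Proof. exact: (@rpred_sum R^o). Qed.

Lemma ideal_genP s x :
  x \in ideal_gen s <-> exists c : nat -> R, x = \sum_(i < size s) c i * s`_i.
Proof.
split=> [/asboolP[c ->]|[c ->]]; last by apply/asboolP; exists (fun i => c i).
exists (fun i => if insub i is Some j then c j else 0).
by apply: eq_bigr => i _; rewrite valK.
Qed.

Lemma ideal_gen_mem s x : x \in s -> x \in ideal_gen s.
Proof.
move=> xs; apply/ideal_genP; exists (fun i => (i == index x s)%:R).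
have xi : (index x s < size s)%N by rewrite index_mem.
rewrite (bigD1 (Ordinal xi)) //= eqxx mul1r nth_index // big1 ?addr0 // => i.
by rewrite -val_eqE /= => /negPf ->; rewrite mul0r.
Qed.

Lemma ideal_gen_sub s A : {subset s <= A} -> {subset ideal_gen s <= A}.
Proof.
move=> sA x /ideal_genP[c ->]; apply: rpred_sum => i _; apply: idealM.
exact/sA/mem_nth.
Qed.

Lemma add1_closed (V : lmodType R) (N : submodule V) (x : V) :
  lin_closed (fun y => exists a, y - a *: x \in N).
Proof.
split=> [|a y z [b yN] [c zN]]; first by exists 0; rewrite scale0r subr0 rpred0.
exists (a * b + c); rewrite scalerDl opprD addrACA -scalerA -scalerBr.
by rewrite rpredD ?rpredZ.
Qed.
Definition add1_sub (V : lmodType R) (N : submodule V) x := propsub (add1_closed N x).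

Lemma sub_add1 (V : lmodType R) (N : submodule V) x : {subset N <= add1_sub N x}.
Proof. by move=> y yN; apply/propsubP; exists 0; rewrite scale0r subr0. Qed.

Lemma mem_add1 (V : lmodType R) (N : submodule V) x : x \in add1_sub N x.
Proof. by apply/propsubP; exists 1; rewrite scale1r subrr rpred0. Qed.

(** Without a maximal element, choice gives a strictly increasing chain; its union is finitely
    generated, and the generators already lie in one term. *)
Lemma noeth_max (Q : ideal R -> Prop) A0 : noetherian R -> Q A0 ->
  exists A, [/\ Q A, {subset A0 <= A} &
    forall B, Q B -> {subset A <= B} -> {subset B <= A}].
Proof.
move=> noe QA0; apply: contrapT => /forallNP nomax.
pose T := {A : ideal R | Q A /\ {subset A0 <= A}}.
have /choice[nxt nxtP] : forall A : T, exists B : T,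
    {subset sval A <= sval B} /\ ~ {subset sval B <= sval A}.
  move=> [A [QA A0A]]; apply: contrapT => /forallNP H; apply: (nomax A).
  split=> // B QB AB; apply: contrapT => nBA.
  have B0 : {subset A0 <= B} by move=> x /A0A /AB.
  by apply: (H (exist _ B (conj QB B0))).
have A00 : {subset A0 <= A0} by [].
pose C i := sval (iter i nxt (exist _ A0 (conj QA0 A00))).
have CS i : {subset C i <= C i.+1} /\ ~ {subset C i.+1 <= C i} by apply: nxtP.
have Cmono i j : (i <= j)%N -> {subset C i <= C j}.
  move/subnK <-; elim: (j - i)%N => // k IH x /IH; exact: (CS _).1.
have Uc : lin_closed (fun x : R^o => exists i, x \in C i).
  split=> [|a x y [i xi] [j yj]]; first by exists 0%N; rewrite rpred0.
  exists (maxn i j); rewrite rpredD ?rpredZ //.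
    by apply: Cmono xi; rewrite leq_maxl.
  by apply: Cmono yj; rewrite leq_maxr.
have [s sU] := noe (propsub Uc).
have [k sk] : exists k, {subset s <= C k}.
  have : {subset s <= propsub Uc} by move=> x xs; rewrite -sU ideal_gen_mem.
  elim: s {sU} => [|x s IH] sU; first by exists 0%N.
  have [|k sk] := IH; first by move=> y ys; apply: sU; rewrite inE ys orbT.
  have [i xi] := iffLR (propsubP Uc x) (sU x (mem_head x s)).
  exists (maxn i k) => y; rewrite inE => /orP[/eqP->|/sk].
    by apply: Cmono xi; rewrite leq_maxl.
  by apply: Cmono; rewrite leq_maxr.
have [_] := CS k; apply => x xk; apply: (ideal_gen_sub sk); rewrite sU.
by apply/propsubP; exists k.+1.
Qed.

Lemma exists_maximal A : noetherian R -> 1 \notin A ->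
  exists2 B, maximal_ideal B & {subset A <= B}.
Proof.
move=> noe A1; have [B [B1 AB Bmax]] := noeth_max (Q := fun B => 1 \notin B) noe A1.
by exists B.
Qed.

(** An ideal maximal among those that miss the multiplicative set [S] is prime. *)
Lemma exists_prime_disjoint (S : R -> Prop) A : noetherian R -> S 1 ->
  (forall a b, S a -> S b -> S (a * b)) -> (forall a, a \in A -> ~ S a) ->
  exists P, [/\ prime_ideal P, {subset A <= P} & forall a, a \in P -> ~ S a].
Proof.
move=> noe S1 SM AS.
have [P [PS AP Pmax]] := noeth_max (Q := fun B => forall a, a \in B -> ~ S a) noe AS.
exists P; split=> //; split; first by apply/negP => /PS.
have meet x : x \notin P -> exists a b, [/\ S a & a - b * x \in P].
  move=> xP; apply: contrapT => /forallNP H.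
  have /(Pmax (add1_sub P x)) : forall a, a \in add1_sub P x -> ~ S a.
    by move=> a /propsubP[b ab] Sa; apply: (H a); exists b.
  move=> /(_ (@sub_add1 _ P x)) /(_ x); rewrite (negPf xP) => /(_ (mem_add1 _ _)).
  by [].
move=> u v uvP; apply: contraT; rewrite negb_or.
move=> /andP[/meet[a [b [Sa ab]]] /meet[c [e [Sc ce]]]].
suff acP : a * c \in P by case: (PS _ acP); exact: SM.
have -> : a * c = c * (a - b * u) + b * u * (c - e * v) + b * e * (u * v) by ring.
by apply: idealD; [apply: idealD|]; exact: idealM.
Qed.

End Ideals.

(** * Noetherian local rings *)

Section IdealMul.
Context {R : comNzRingType}.
Implicit Types (A B C m : ideal R).

Lemma ideal_mul_mem A B (a b : R) : a \in A -> b \in B -> a * b \in ideal_mul A B.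
Proof.
move=> aA bB; apply/asboolP; exists [:: (a, b)]; last by rewrite big_seq1.
by move=> p; rewrite inE => /eqP->.
Qed.

Lemma ideal_mul_sub A B C : (forall a b : R, a \in A -> b \in B -> a * b \in C) ->
  {subset ideal_mul A B <= C}.
Proof.
move=> ABC x /asboolP[s sAB ->]; rewrite big_seq.
elim/big_ind: _ => [|y z yC zC|p /sAB[pA pB]]; first exact: ideal0.
  exact: idealD.
exact: ABC.
Qed.

Lemma ideal_exp1 A : ideal_exp A 1 =i A.
Proof.
move=> x; apply/idP/idP.
  by apply: ideal_mul_sub => a b aA _; exact: idealMC.
by move=> xA; have := ideal_mul_mem xA (ideal_gen_mem (mem_head 1 [::])); rewrite mulr1.
Qed.

Lemma ideal_exp2_mem A (a b : R) : a \in A -> b \in A -> a * b \in ideal_exp A 2.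
Proof. by move=> aA bA; apply: ideal_mul_mem => //; rewrite ideal_exp1. Qed.

Lemma ideal_exp2_sub A C : (forall a b : R, a \in A -> b \in A -> a * b \in C) ->
  {subset ideal_exp A 2 <= C}.
Proof.
by move=> H; apply: ideal_mul_sub => a b aA; rewrite ideal_exp1; exact: H.
Qed.

Lemma ideal_exp_anti A k l : (k <= l)%N -> {subset ideal_exp A l <= ideal_exp A k}.
Proof.
move/subnK <-; elim: (l - k)%N => // i IH x; rewrite addSn => xA; apply: IH.
by move: x xA; apply: ideal_mul_sub => a b _ bA; apply: idealM.
Qed.

End IdealMul.

Section Generators.
Context {R : comNzRingType}.
Implicit Types (A m : ideal R).

Definition gens k (x : 'I_k -> R) A :=
  forall y : R, y \in A <-> exists c : 'I_k -> R, y = \sum_i c i * x i.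

(** For generators of an ideal of a local ring this is minimality, in the form in which it is used:
    no relation has a unit coefficient. *)
Definition minrel m k (x : 'I_k -> R) :=
  forall c : 'I_k -> R, \sum_i c i * x i = 0 -> forall i, c i \in m.

Lemma sum_delta k (F : 'I_k -> R) i : \sum_j (j == i)%:R * F j = F i.
Proof.
by rewrite (bigD1 i) //= eqxx mul1r big1 ?addr0 // => j /negPf->; rewrite mul0r.
Qed.

Lemma gens_mem k (x : 'I_k -> R) A i : gens x A -> x i \in A.
Proof.
by move=> gx; apply/gx; exists (fun j => (j == i)%:R); rewrite sum_delta.
Qed.

Lemma gens_seq r (a : r.-tuple R) A : ideal_gen a =i A -> gens (fun i : 'I_r => a`_i) A.
Proof.
move=> aA y; rewrite -aA; apply: (iff_trans (ideal_genP _ _)); rewrite size_tuple.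
split=> -[c ->]; first by exists (fun i => c i).
exists (fun i => if insub i is Some j then c j else 0).
by apply: eq_bigr => i _; rewrite valK.
Qed.

End Generators.

(** * Minimal generators, primes over a regular sequence, and socles *)

Section Local.
Context {R : comNzRingType} {m : ideal R}.
Hypothesis noe : noetherian R.
Hypothesis loc : local m.
Implicit Types (A B C J P Q : ideal R).

Lemma local1 : 1 \notin m. Proof. exact: loc.1.1. Qed.

Lemma proper_sub_local A : 1 \notin A -> {subset A <= m}.
Proof.
by move=> /(exists_maximal noe)[B /loc.2 Bm AB] x /AB; rewrite Bm.
Qed.

Lemma local_unit (x : R) : x \notin m -> exists y, y * x = 1.
Proof.
move=> xm; have Ac : lin_closed (fun y : R^o => exists a : R, y = a * x).
  split=> [|a y z [b ->] [c ->]]; first by exists 0; rewrite mul0r.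
  by exists (a * b + c); rewrite /GRing.scale /= mulrDl mulrA.
have [A1|A1] := boolP (1 \in propsub Ac).
  by have [y ->] := iffLR (propsubP Ac 1) A1; exists y.
case/negP: xm; apply: (proper_sub_local A1).
by apply/(propsubP Ac); exists 1; rewrite mul1r.
Qed.

Lemma local_subr1 (x : R) : x \in m -> 1 - x \notin m.
Proof.
by move=> xm; apply/negP => H; case/negP: local1; rewrite -(subrK x 1) idealD.
Qed.

Lemma local_colon A (x a : R) : a * x \in A -> x \notin A -> a \in m.
Proof.
move=> axA xA; apply: contraT => /local_unit[b ba].
by case/negP: xA; rewrite -[x]mul1r -ba -mulrA idealM.
Qed.

Lemma local_prime : prime_ideal m.
Proof.
split=> [|u v uvm]; first exact: local1.
by case: (boolP (v \in m)) => [_|/(local_colon uvm) ->]; rewrite ?orbT.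
Qed.

(** A generating family of least size works: a unit coefficient in a relation would make one
    generator redundant. *)
Lemma min_gens_exists A : exists k (x : 'I_k -> R), gens x A /\ minrel m x.
Proof.
have ex : exists k, `[< exists x : 'I_k -> R, gens x A >].
  have [s sA] := noe A; exists (size s); apply/asboolP.
  by exists (fun i => s`_i); exact: (@gens_seq _ _ (in_tuple s)).
case: (ex_minnP ex) => k /asboolP[x gx] kmin; exists k, x; split=> // c c0 i.
apply: contraT => /local_unit[b bc].
case: k x gx kmin c c0 i bc => [|k] x gx kmin c c0 i bc; first by case: i bc.
suff /kmin : `[< exists x : 'I_k -> R, gens x A >] by rewrite ltnn.
apply/asboolP; exists (x \o lift i) => y.
have xi : x i = \sum_j - b * c (lift i j) * x (lift i j).
  move: c0; rewrite (bigD1_ord i) //= => /eqP; rewrite addr_eq0 => /eqP c0.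
  rewrite -[x i]mul1r -bc -mulrA c0 mulrN mulr_sumr -sumrN.
  by apply: eq_bigr => j _; rewrite !mulNr mulrA.
split=> [/gx[e ->]|[e ->]].
  exists (fun j => e (lift i j) - e i * b * c (lift i j)).
  rewrite (bigD1_ord i) //= xi mulr_sumr -big_split /=.
  by apply: eq_bigr => j _; ring.
by apply: ideal_sum => j _; apply: idealM; apply: gens_mem gx.
Qed.

(** The same elimination; minimality speaks of sublists here, so the redundant entry is cut out by
    [take] and [drop]. *)
Lemma minimal_generators_minrel r (a : r.-tuple R) A :
  minimal_generators A a -> minrel m (fun i : 'I_r => a`_i).
Proof.
move=> [aA amin] c c0 i; apply: contraT => /local_unit[b bc].
pose t := take i a ++ drop i.+1 a; have ia : (i < size a)%N by rewrite size_tuple.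
have mem_t (j : 'I_r) : j != i -> a`_j \in ideal_gen t.
  rewrite -val_eqE /= neq_ltn => ji; apply: ideal_gen_mem; rewrite mem_cat.
  case/orP: ji => ij.
    by rewrite -(nth_take 0 ij) mem_nth // size_takel // ltnW.
  apply/orP; right; rewrite -(subnKC ij) -nth_drop mem_nth //.
  by rewrite size_drop ltn_sub2r ?size_tuple // (leq_ltn_trans ij).
have ta : subseq t a.
  by rewrite -[X in subseq _ X](cat_take_drop i) cat_subseq // (drop_nth 0 ia) subseq_cons.
suff /(amin t ta) /(congr1 size) : ideal_gen t =i A.
  rewrite size_cat size_takel ?size_drop; last exact: ltnW.
  by move=> H; move: (ia) (H) => /subnKC; lia.
have at_ : {subset a <= ideal_gen t}.
  move=> x /(nthP 0)[j]; rewrite size_tuple => jr <-.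
  have [ji|ji] := eqVneq (Ordinal jr) i; last exact: mem_t ji.
  have -> : a`_j = \sum_(k | k != i) - b * c k * a`_k.
    move: c0; rewrite (bigD1 i) //= => /eqP; rewrite addr_eq0 => /eqP c0.
    rewrite -[j]/(val (Ordinal jr)) ji -[a`_i]mul1r -bc -mulrA c0 mulrN mulr_sumr -sumrN.
    by apply: eq_bigr => k _; rewrite !mulNr mulrA.
  by apply: ideal_sum => k ki; apply: idealM; apply: mem_t.
move=> x; rewrite -aA; apply/idP/idP; last exact: ideal_gen_sub.
by apply: ideal_gen_sub => y /(mem_subseq ta) /ideal_gen_mem.
Qed.

(** As [z_i] is regular modulo its predecessors, some prime over their ideal lies inside [P] and
    omits [z_i], hence is strictly smaller; the chain grows downwards from [P]. *)
Lemma prime_chain_regular z i P : regular_sequence z -> (i <= size z)%N ->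
  prime_ideal P -> {subset ideal_gen (take i z) <= P} ->
  exists C : nat -> ideal R, [/\ forall j, (j <= i)%N -> prime_ideal (C j),
    forall j, (j < i)%N -> {subset C j <= C j.+1} /\ ~ {subset C j.+1 <= C j} &
    C i = P].
Proof.
move=> [z1 zreg]; elim: i P => [|i IH] P iz Pp JP.
  by exists (fun=> P); split.
have JJ : {subset ideal_gen (take i z) <= ideal_gen (take i.+1 z)}.
  apply: ideal_gen_sub => x xz; apply: ideal_gen_mem.
  by rewrite (take_nth 0 iz) mem_rcons inE xz orbT.
have ziP : z`_i \in P.
  by apply/JP/ideal_gen_mem; rewrite (take_nth 0 iz) mem_rcons mem_head.
(* A prime that misses all products of an element outside [P] and a power of [z_i] is contained in
   [P] and omits [z_i]. *)
pose S a := exists s k, s \notin P /\ a = s * z`_i ^+ k.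
have [P' [P'p JP' P'S]] : exists P', [/\ prime_ideal P',
    {subset ideal_gen (take i z) <= P'} & forall a, a \in P' -> ~ S a].
  apply: exists_prime_disjoint => //.
  - by exists 1, 0%N; split; [exact: Pp.1|rewrite mulr1].
  - move=> _ _ [s [k [sP ->]]] [t [l [tP ->]]]; exists (s * t), (k + l)%N; split.
      by apply/negP => /Pp.2; rewrite (negPf sP) (negPf tP).
    by rewrite exprD; ring.
  - move=> a aJ [s [k [sP ak]]]; case/negP: sP; apply/JP/JJ.
    rewrite {}ak in aJ; elim: k aJ => [|k IHk]; first by rewrite mulr1.
    by rewrite exprS mulrCA => /(zreg _ iz).
have P'P : {subset P' <= P}.
  move=> x xP'; apply: contraT => xP; case: (P'S x xP').
  by exists x, 0%N; rewrite mulr1.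
have [C [Cp CS Ci]] := IH P' (ltnW iz) P'p JP'.
exists (fun j => if (j <= i)%N then C j else P); split=> [j _|j|].
- by case: ifP => // /Cp.
- have [-> _|ji ji1] := eqVneq j i; last first.
    have {ji1}ji : (j < i)%N by rewrite ltn_neqAle ji -ltnS.
    by rewrite ji (ltnW ji); exact: CS.
  rewrite leqnn ltnn Ci; split=> // /(_ _ ziP) /P'S; apply.
  by exists 1, 1%N; rewrite mul1r; split=> //; exact: Pp.1.
- by rewrite ltnn.
Qed.

(** Otherwise the chain of length [d] ending at [P], continued by [m], would be longer than the
    dimension allows. *)
Lemma prime_over_parameters d (z : d.-tuple R) P : krull_dim R d ->
  regular_sequence z -> prime_ideal P -> {subset ideal_gen z <= P} -> {subset m <= P}.
Proof.
move=> [_ dimR] zreg Pp JP; apply: contrapT => nmP.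
have dz : (d <= size z)%N by rewrite size_tuple.
have JP' : {subset ideal_gen (take d z) <= P} by rewrite take_oversize ?size_tuple.
have [C [Cp CS Cd]] := prime_chain_regular zreg dz Pp JP'.
suff /dimR : has_prime_chain R d.+1 by rewrite ltnn.
exists (fun j => if (j <= d)%N then C j else m); split=> j.
  by case: ifP => [/Cp//|_ _]; exact: local_prime.
have [-> _|jd jd1] := eqVneq j d; last first.
  have {jd1}jd : (j < d)%N by rewrite ltn_neqAle jd -ltnS.
  by rewrite jd (ltnW jd); exact: CS.
by rewrite leqnn ltnn Cd; split=> //; exact/proper_sub_local/Pp.1.
Qed.

(* A maximal element among the ideals Q : x with x not in Q is prime.          *)
Lemma socle_nonzero J Q :
  (forall P, prime_ideal P -> {subset J <= P} -> {subset m <= P}) ->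
  {subset J <= Q} -> 1 \notin Q ->
  exists2 x : R, x \notin Q & forall a : R, a \in m -> a * x \in Q.
Proof.
move=> mprime JQ Q1.
have cc (x : R) : lin_closed (fun a : R^o => (a : R) * x \in Q).
  split=> [|a b c bx cx]; first by rewrite mul0r ideal0.
  by rewrite mulrDl idealD // /GRing.scale /= -mulrA idealM.
pose F A := exists2 x : R, x \notin Q & A =i propsub (cc x).
have F1 : F (propsub (cc 1)) by exists 1.
have [A [[x xQ Ax] _ Amax]] := noeth_max noe F1.
have AxE (a : R) : (a \in A) = (a * x \in Q).
  by rewrite Ax; apply/idP/idP => /(propsubP (cc x)).
exists x => // a am; rewrite -AxE; move: a am; apply: mprime => [|a /JQ aQ].
  split=> [|u v]; first by rewrite AxE mul1r.
  rewrite !AxE => uvx; case: (boolP (v * x \in Q)) => [_|vx]; first by rewrite orbT.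
  rewrite orbF -AxE; apply: (Amax (propsub (cc (v * x)))).
  - by exists (v * x).
  - by move=> a; rewrite AxE => ax; apply/(propsubP (cc _)); rewrite mulrCA idealM.
  - by apply/(propsubP (cc _)); rewrite mulrA.
by rewrite AxE idealMC.
Qed.

(** Let [Q] be maximal among the ideals over [J] of infinite colength. Adjoining a socle element of
    [R / Q] gives an ideal of finite colength only one step larger, a contradiction. *)
Lemma finite_colength J :
  (forall P, prime_ideal P -> {subset J <= P} -> {subset m <= P}) ->
  exists l, ilen J (top_sub R^o) l.
Proof.
move=> mprime; apply: contrapT => nJ.
pose F A := {subset J <= A} /\ ~ exists l, ilen A (top_sub R^o) l.
have FJ : F J by split.
have [Q [[JQ nQ] _ Qmax]] := noeth_max noe FJ.
have subtop (A : ideal R) : {subset A <= top_sub R^o} by move=> x _; exact: in_top.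
have [Q1|Q1] := boolP (1 \in Q).
  by apply: nQ; exists 0%N; apply: ilen0 => // x _; rewrite -[x]mulr1; exact: idealM.
have [x xQ mx] := socle_nonzero mprime JQ Q1.
have [[l Ql]|nl] := pselect (exists l, ilen (add1_sub Q x) (top_sub R^o) l); last first.
  case/negP: xQ; apply: (Qmax (add1_sub Q x)); last exact: mem_add1.
    by split=> // y /JQ; exact: sub_add1.
  exact: sub_add1.
apply: nQ; exists (#|{: unit}| + l)%N.
apply: (ilen_add (@sub_add1 _ _ Q x) (subtop _)) Ql.
apply: (@ilen_span _ m R^o _ (fun=> x)) => //.
- exact/ilen_maximal/loc.1.
- exact: sub_add1.
- by move=> _; exact: mem_add1.
- by move=> a _; exact: mx.
- move=> y /propsubP[a ya]; exists (fun=> a).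
  by rewrite (bigD1 tt) //= big1 ?addr0 //; case.
- move=> c; rewrite (bigD1 tt) //= big1 ?addr0; last by case.
  by move=> cx [] ; apply: local_colon cx xQ.
Qed.

(** If [m] were generated by one element [x0], the middle term of a chain of primes
    [P 0 < P 1 < P 2] would satisfy [P 1 = x0 * P 1], hence vanish by Nakayama and lie in [P 0]. *)
Lemma embedding_dim_ge2 d k (x : 'I_k -> R) : krull_dim R d -> (2 <= d)%N ->
  gens x m -> (2 <= k)%N.
Proof.
move=> [[P [Pp PS]] _] d2 gx; rewrite ltnNge; apply/negP => k1.
have [x0 [x0m mx0]] : exists x0 : R, x0 \in m /\ forall p, p \in m -> exists c, p = c * x0.
  case: k x gx k1 => [|[|//]] x gx _.
    exists 0; split=> [|p /gx[c ->]]; first exact: ideal0.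
    by exists 0; rewrite big_ord0 mul0r.
  exists (x ord0); split=> [|p /gx[c ->]]; first exact: gens_mem gx.
  by exists (c ord0); rewrite big_ord1.
have [_ P01] := PS 0%N (ltnW d2); have [P12 nP12] := PS 1%N d2.
have P2m : {subset P 2%N <= m} by apply: proper_sub_local; exact: (Pp 2%N d2).1.
have xP : x0 \notin P 1%N.
  by apply/negP => xP; apply: nP12 => p /P2m /mx0[c ->]; exact: idealM.
apply: P01; have [l [y [gy my]]] := min_gens_exists (P 1%N).
case: l y gy my => [|l] y gy my.
  by move=> p /gy[c ->]; rewrite big_ord0 ideal0.
have yP := gens_mem ord0 gy; have [c yc] := mx0 _ (P2m _ (P12 _ yP)).
have : c \in P 1%N.
  by move: yP; rewrite yc => /(Pp 1%N (ltnW d2)).2; rewrite (negPf xP) orbF.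
(* The relation is [y_0 = x0 * c] with [c] expanded in the [y_i]; its coefficient at [y_0] is the
   unit [1 - x0 * e_0]. *)
move=> /gy[e ce]; suff /my/(_ ord0) : \sum_i ((i == ord0)%:R - x0 * e i) * y i = 0.
  by rewrite eqxx => H; case/negP: (local_subr1 (idealMC (e ord0) x0m)).
under eq_bigr do rewrite mulrBl -mulrA; rewrite sumrB -mulr_sumr -ce mulrC -yc.
rewrite (bigD1 ord0) //= mul1r big1 ?addr0 ?subrr // => i /negPf->.
by rewrite mul0r.
Qed.

End Local.

(** * Extension of maps from ideals *)

Section PartialLinear.
Context {R : comNzRingType}.
Implicit Types (A B J m : ideal R) (E : lmodType R).

Definition lin_on A E (phi : R -> E) := forall a x y : R,
  x \in A -> y \in A -> phi (a * x + y) = a *: phi x + phi y.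

Lemma lin_on0 A E (phi : R -> E) : lin_on A phi -> phi 0 = 0.
Proof.
by move=> /(_ (-1) 0 0 (ideal0 A) (ideal0 A)); rewrite mulr0 addr0 scaleN1r addNr.
Qed.

Lemma lin_onZ A E (phi : R -> E) a x :
  lin_on A phi -> x \in A -> phi (a * x) = a *: phi x.
Proof.
move=> phil xA; have := phil a x 0 xA (ideal0 A).
by rewrite addr0 (lin_on0 phil) addr0.
Qed.

Lemma injective_baer A E (phi : R -> E) : injective_module E -> lin_on A phi ->
  exists e, forall a, a \in A -> phi a = a *: e.
Proof.
move=> Einj phil; pose g (x : sub_module A) := phi (val x).
have gl : linear g.
  by move=> a x y; rewrite /g linearP; apply: phil; exact: valP.
pose G : {linear sub_module A -> E} :=
  HB.pack g (GRing.isLinear.Build R (sub_module A) E *:%R g gl).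
have [h hG] := Einj _ _ (\val : {linear sub_module A -> R^o}) G val_inj.
exists (h 1) => a aA; have <- : h a = phi a := hG (Sub a aA).
by rewrite -linearZ; congr (h _); rewrite /GRing.scale /= mulr1.
Qed.

(** The hypothesis on [phi] makes [x |-> c] agree with [phi] on the multiples of [x] in [A], so the
    value at [a + b * x] does not depend on the choice of [b]. *)
Lemma lin_extend A E (phi : R -> E) (x : R) (c : E) : lin_on A phi ->
  (forall b, b * x \in A -> phi (b * x) = b *: c) ->
  exists psi : R -> E, [/\ lin_on (add1_sub A x) psi,
    forall a, a \in A -> psi a = phi a, psi x = c &
    forall y, y \in add1_sub A x -> exists2 a, a \in A & exists b, psi y = phi a + b *: c].
Proof.
move=> phil phix.
have [b bP] : exists b : R -> R, forall y, y \in add1_sub A x -> y - b y * x \in A.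
  have /choice[b bP] y : exists b : R, y \in add1_sub A x -> y - b * x \in A.
    have [yA|nyA] := pselect (y \in add1_sub A x); last by exists 0.
    by have [b yb] := iffLR (propsubP _ _) yA; exists b.
  by exists b.
have phiD y y' : y \in A -> y' \in A -> phi (y + y') = phi y + phi y'.
  by move=> yA yA'; have := phil 1 y y' yA yA'; rewrite mul1r scale1r.
pose psi y := phi (y - b y * x) + b y *: c.
have psiE y b' : y - b' * x \in A -> psi y = phi (y - b' * x) + b' *: c.
  move=> yb'; have yA : y \in add1_sub A x by apply/(propsubP (add1_closed A x)); exists b'.
  have yb := bP _ yA; rewrite /psi.
  have -> : y - b y * x = (y - b' * x) + (b' - b y) * x by ring.
  have bx : (b' - b y) * x \in A.
    have -> : (b' - b y) * x = y - b y * x - (y - b' * x) by ring.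
    exact: idealB.
  by rewrite phiD // phix // -addrA -scalerDl subrK.
exists psi; split.
- move=> a y y' /bP yA /bP yA'.
  have E1 : a * y + y' - (a * b y + b y') * x = a * (y - b y * x) + (y' - b y' * x) by ring.
  rewrite (psiE _ (a * b y + b y')) E1; last by rewrite idealD // idealM.
  by rewrite phil // /psi scalerDr scalerDl scalerA addrACA.
- move=> a aA; rewrite (psiE _ 0) mul0r subr0 //.
  by rewrite scale0r addr0.
- by rewrite (psiE _ 1) mul1r subrr ?ideal0 // (lin_on0 phil) scale1r add0r.
- by move=> y /bP yA; exists (y - b y * x) => //; exists (b y).
Qed.

Definition killed J E (y : E) := forall a, a \in J -> a *: y = 0.

Lemma killed0 J E : killed J (0 : E).
Proof. by move=> a _; rewrite scaler0. Qed.

Lemma killedB J E (y y' : E) : killed J y -> killed J y' -> killed J (y - y').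
Proof. by move=> ky ky' a aJ; rewrite scalerBr ky // ky' // subrr. Qed.

Lemma killedZ J E c (y : E) : killed J y -> killed J (c *: y).
Proof. by move=> ky a aJ; rewrite scalerA mulrC -scalerA ky // scaler0. Qed.

Lemma killed_lin J E E' (f : {linear E -> E'}) (y : E) : killed J y -> killed J (f y).
Proof. by move=> ky a aJ; rewrite -linearZ /= ky // linear0. Qed.

(** Since [x] is regular modulo [J], some map on [J + R x] kills [J] and sends [x] to [y]; an
    element representing it is the quotient. *)
Lemma killed_divisible J E (x : R) (y : E) : injective_module E ->
  (forall r, x * r \in J -> r \in J) -> killed J y ->
  exists2 y', killed J y' & y = x *: y'.
Proof.
move=> Einj xreg ky.
have l0 : lin_on J (fun _ => 0 : E) by move=> a b c _ _; rewrite scaler0 addr0.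
have [|psi [psil psi0 psix _]] := lin_extend (x := x) (c := y) l0.
  by move=> b; rewrite mulrC => /xreg /ky.
have [e eP] := injective_baer Einj psil; exists e => [a aJ|].
  by rewrite -eP ?psi0 //; exact: sub_add1.
by rewrite -eP ?psix //; exact: mem_add1.
Qed.

(** Every map from [A / J] to [Z] is multiplication by an element of [Z]. For [Z] killed by [J],
    [baer] is Baer's criterion over [R / J]. *)
Definition baer_at J A E (Z : submodule E) := forall phi : R -> E,
  lin_on A phi -> (forall a, a \in A -> phi a \in Z) ->
  (forall a, a \in J -> phi a = 0) ->
  exists2 e, e \in Z & forall a, a \in A -> phi a = a *: e.

Definition baer J E (Z : submodule E) := forall A, {subset J <= A} -> baer_at J A Z.

End PartialLinear.

Section BaerLocal.
Context {R : comNzRingType} {m J : ideal R}.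
Hypothesis noe : noetherian R.
Hypothesis loc : local m.
Hypothesis Jm : {subset J <= m}.
Hypothesis primeJ : forall P, prime_ideal P -> {subset J <= P} -> {subset m <= P}.
Implicit Types (A B : ideal R) (E : lmodType R).

(** Take a maximal extension [psi], defined on [B]. If [B] is proper, a socle element [x] of [R / B]
    gives a map [a |-> psi (a * x)] on [m]; an element representing it is an admissible value at
    [x]. *)
Lemma baer_at_max E (Z : submodule E) : baer_at J m Z -> baer J Z.
Proof.
move=> kinj A JA phi phil phiZ phi0.
pose F B := {subset A <= B} /\ exists psi, [/\ lin_on B psi,
  forall a, a \in B -> psi a \in Z & forall a, a \in A -> psi a = phi a].
have FA : F A by split=> //; exists phi.
have [B [[AB [psi [psil psiZ psiA]]] _ Bmax]] := noeth_max noe FA.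
have [B1|B1] := boolP (1 \in B).
  exists (psi 1) => [|a aA]; first exact: psiZ.
  by rewrite -psiA // -[a in LHS]mulr1 (lin_onZ _ psil).
have JB : {subset J <= B} by move=> a /JA /AB.
have [x xB mx] := socle_nonzero noe primeJ JB B1.
have [||a aJ|c cZ cP] := kinj (fun a => psi (a * x)).
- move=> a y y' ym ym'; rewrite mulrDl -mulrA.
  by apply: psil; exact: mx.
- by move=> a am; apply/psiZ/mx.
- by rewrite psiA ?phi0 ?JA // idealMC.
have [|psi' [psil' psiB psix psiE]] := lin_extend (x := x) (c := c) psil.
  by move=> b bx; apply: cP; apply: (local_colon noe loc bx xB).
case/negP: xB; apply: (Bmax (add1_sub B x)); last exact: mem_add1.
  split=> [y /AB|]; first exact: sub_add1.
  exists psi'; split=> // [y /psiE[a aB [b ->]]|a aA].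
    by rewrite rpredD ?rpredZ ?psiZ.
  by rewrite psiB ?psiA ?AB.
exact: sub_add1.
Qed.

(* Every socle element e of Z' is a multiple u * y with y in Z', because       *)
(* R / m embeds in R / J through u; then u * y lifts to a socle element of E.  *)
Lemma baer_kernel E E' (f : {linear E -> E'}) (Z : submodule E) (Z' : submodule E') :
  injective_module E -> 1 \notin J ->
  (forall y, y \in Z <-> killed J y /\ f y = 0) ->
  (forall y, killed J y -> f y \in Z') ->
  (forall y, y \in Z' -> exists2 y', killed J y' & y = f y') ->
  baer J Z' -> baer J Z.
Proof.
move=> Einj J1 ZP fZ' Z'f bZ'; apply: baer_at_max => phi phil phiZ phi0.
have [e eP] := injective_baer Einj phil.
have ke : killed J e by move=> a aJ; rewrite -eP ?phi0 ?Jm.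
have me a : a \in m -> a *: f e = 0.
  by move=> am; rewrite -linearZ /= -eP //; have /ZP[] := phiZ _ am.
have [u uJ mu] := socle_nonzero noe primeJ (fun _ => id) J1.
have l0 : lin_on J (fun _ => 0 : E') by move=> a b c _ _; rewrite scaler0 addr0.
have [|psi [psil psi0 psiu psiE]] := lin_extend (x := u) (c := f e) l0.
  by move=> b bu; rewrite me //; exact: (local_colon noe loc bu uJ).
have [||y yZ yP] := bZ' _ (@sub_add1 _ _ J u) psi psil.
- move=> a /psiE[_ _ [b ->]]; rewrite add0r rpredZ //; exact: fZ'.
- exact: psi0.
have [y' ky' yy'] := Z'f _ yZ.
have muy a : a \in m -> a *: (u *: y') = 0 by move=> am; rewrite scalerA ky' ?mu.
(* Subtracting [u *: y'] moves [e] into the kernel of [f] and changes no product with an element of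
   [m]. *)
exists (e - u *: y') => [|a am].
  apply/ZP; split; first exact/killedB/killedZ.
  by rewrite linearB linearZ /= -yy' -yP ?psiu ?subrr //; exact: mem_add1.
by rewrite scalerBr muy // subr0 eP.
Qed.

End BaerLocal.

(** * Injective resolutions modulo a regular sequence *)

Section Complex.
Context {R : comNzRingType} (E : nat -> lmodType R).
Variable f : forall i, {linear E i -> E i.+1}.
Hypothesis Einj : forall i, injective_module (E i).
Hypothesis ff : forall i x, f i.+1 (f i x) = 0.
Implicit Types (A B J m : ideal R).

(* Boundaries in degree j of the subcomplex of elements killed by A.           *)
Definition bd A j : E j -> Prop :=
  if j is j'.+1 then fun y => exists2 y', killed A y' & y = f j' y'
  else fun y => y = 0.

Lemma bd_closed A j : lin_closed (@bd A j).
Proof.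
case: j => [|j] /=; first exact: zero_closed.
split=> [|a y z [y' ky ->] [z' kz ->]]; first by exists 0; rewrite ?linear0 //; exact: killed0.
exists (a *: y' + z'); last by rewrite linearP.
by rewrite -[z']opprK; apply: killedB; [exact: killedZ|rewrite -scaleN1r; exact: killedZ].
Qed.

Lemma bdZ A j c (y : E j) : bd A y -> bd A (c *: y).
Proof.
by move=> by_; rewrite -[_ *: _]addr0; apply: (bd_closed A j).2 => //; exact: (bd_closed A j).1.
Qed.

Lemma bd_killed A j (y : E j) : bd A y -> killed A y.
Proof.
case: j y => [|j] y /=; first by move=> ->; exact: killed0.
by move=> [y' ky ->]; exact: killed_lin.
Qed.

Lemma bd_cycle A j (y : E j) : bd A y -> f j y = 0.
Proof. by case: j y => [|j] y /= => [->|[y' _ ->]]; rewrite ?linear0 ?ff. Qed.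

Definition acyclic_at A j := forall y : E j, killed A y -> f j y = 0 -> bd A y.

(** The elements of the complex killed by [A], that is [Hom(R / A, E)], have cohomology only in
    degree [i], where it is [R / A] with generator the class of [g]. *)
Definition cohomology_at A i := (forall j, j != i -> acyclic_at A j) /\
  exists g : E i, [/\ killed A g, f i g = 0,
    forall y, killed A y -> f i y = 0 -> exists c, bd A (y - c *: g) &
    forall c, bd A (c *: g) -> c \in A].

Section Step.
Context {A B : ideal R} {x : R} {i : nat}.
Hypothesis xreg : forall r, x * r \in A -> r \in A.
Hypothesis BE : forall y, y \in B <-> exists a, y - a * x \in A.

Lemma killed_step j (y : E j) : killed B y <-> killed A y /\ x *: y = 0.
Proof.
split=> [ky|[ky xy] b /BE[a ba]].
  split=> [a aA|]; first by apply/ky/BE; exists 0; rewrite mul0r subr0.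
  by apply/ky/BE; exists 1; rewrite mul1r subrr ideal0.
by rewrite -(subrK (a * x) b) scalerDl ky // -scalerA xy scaler0 addr0.
Qed.

Lemma bd_divisible j (y : E j) : bd A y -> exists2 y', bd A y' & y = x *: y'.
Proof.
case: j y => [|j] y /= => [->|[z kz ->]]; first by exists 0; rewrite ?scaler0.
have [z' kz' ->] := killed_divisible (@Einj j) xreg kz.
by exists (f j z'); [exists z'|rewrite linearZ].
Qed.

(** The cycle [x *: t] is a boundary, hence [x] times a boundary [b]; passing from [t] to [t - b]
    keeps the differential. *)
Lemma correct_to_killed j (t : E j) : acyclic_at A j -> killed A t ->
  x *: f j t = 0 -> exists2 t', killed B t' & f j t' = f j t.
Proof.
move=> acA kt xt; have [|b bb xb] := bd_divisible (acA (x *: t) (killedZ _ kt) _).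
  by rewrite linearZ.
exists (t - b); last by rewrite linearB /= (bd_cycle bb) subr0.
apply/killed_step; split; first exact/killedB/(bd_killed bb).
by rewrite scalerBr xb subrr.
Qed.

(** This is the long exact sequence of multiplication by [x] on the elements killed by [A]: it is
    onto by [killed_divisible], with kernel the elements killed by [B]. The new generator is the
    connecting image [f i h], where [g = x *: h]. *)
Lemma cohomology_step : cohomology_at A i -> cohomology_at B i.+1.
Proof.
move=> [acA [g [kg fg gen rel]]]; split.
  move=> j ji y /killed_step[ky xy] fy.
  have : bd A y.
    have [ij|] := eqVneq j i; last by move/acA; exact.
    subst j; have [c cb] := gen y ky fy.
    (* In degree [i] a class [c *: g] killed by [x] vanishes, as [x] is regular modulo [A]. *)
    suff cA : c \in A by move: cb; rewrite kg // subr0.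
    apply/xreg/rel; have := bdZ (- x) cb.
    by rewrite scalerBr scalerA scaleNr xy oppr0 sub0r mulNr scaleNr opprK.
  case: j y ji ky xy fy => [//|j] y ji ky xy fy /= [t kt yt].
  have [|t' kt' ftt] := @correct_to_killed j t (acA j ji) kt; first by rewrite -yt.
  by exists t'; [exact: kt'|rewrite ftt].
have [h kh gh] := killed_divisible (@Einj i) xreg kg.
exists (f i h); split.
- by apply/killed_step; split; [exact: killed_lin|rewrite -linearZ /= -gh].
- exact: ff.
- move=> y /killed_step[ky xy] fy.
  have [t kt yt] := acA i.+1 (negbT (gtn_eqF (ltnSn i))) y ky fy.
  have [|c /bd_divisible[b bb xb]] := gen (x *: t) (killedZ _ kt).
    by rewrite linearZ /= -yt.
  (* From [x *: t = c *: g + x *: b] and [g = x *: h] this element is killed by [x]. *)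
  exists c, (t - c *: h - b).
    apply/killed_step; split.
      by apply: killedB; [apply: killedB => //; exact: killedZ|exact: bd_killed bb].
    by rewrite scalerBr -xb scalerBr scalerA mulrC -scalerA -gh subrr.
  by rewrite !linearB linearZ /= -yt (bd_cycle bb) subr0 linearZ scalerN.
- move=> c /= [t /killed_step[kt xt] ft].
  have [||c' /bd_divisible[b bb cb]] := gen (c *: h - t).
  + by apply: killedB => //; exact: killedZ.
  + by rewrite linearB linearZ /= ft subrr.
  apply/BE; exists c'; apply: rel.
  have -> : (c - c' * x) *: g = x *: (x *: b).
    rewrite -cb !scalerBr xt subr0 gh !scalerA -!scalerBl.
    by congr (_ *: _); ring.
  exact/bdZ/bdZ.
Qed.

End Step.

Lemma cohomology_regular z i : regular_sequence z -> (i <= size z)%N ->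
  cohomology_at (ideal_gen [::]) 0 -> cohomology_at (ideal_gen (take i z)) i.
Proof.
move=> [_ zreg] iz coh0; elim: i iz => [|i IH] iz; first by rewrite take0.
apply: (@cohomology_step _ _ z`_i) (IH (ltnW iz)); first exact: zreg.
move=> y; rewrite (take_nth 0 iz); apply: (iff_trans (ideal_genP _ _)).
rewrite size_rcons; split=> [[c ->]|[a /ideal_genP[c yc]]].
  exists (c (size (take i z))); rewrite big_ord_recr /= nth_rcons ltnn eqxx addrK.
  apply/ideal_genP; exists c; apply: eq_bigr => j _.
  by rewrite nth_rcons ltn_ord.
exists (fun j => if j == size (take i z) then a else c j).
rewrite -(subrK (a * z`_i) y) yc big_ord_recr /= nth_rcons ltnn eqxx; congr (_ + _).
by apply: eq_bigr => j _; rewrite nth_rcons ltn_ord (ltn_eqF (ltn_ord j)).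
Qed.

(* The boundaries B^(j+1) are isomorphic to a complement of B^j, so they split *)
(* off in turn.                                                                *)
Lemma boundary_retract A i : (forall j, (j < i)%N -> acyclic_at A j) ->
  forall j, (j <= i)%N -> exists rho : E j -> E j, [/\ linear rho,
    forall y, killed A y -> bd A (rho y) & forall y, bd A y -> rho y = y].
Proof.
move=> ac; elim=> [|j IH] ji.
  exists (fun _ => 0); split=> //= a y z.
  by rewrite scaler0 addr0.
have [rho [rl rbd rid]] := IH (ltnW ji).
have r0 : rho 0 = 0 by rewrite rid //; exact: (bd_closed A j).1.
have rB y z : rho (y - z) = rho y - rho z.
  by have := rl (-1) z y; rewrite !scaleN1r ![- _ + _]addrC.
have Kc : lin_closed (fun y : E j => killed A y /\ rho y = 0).
  split=> [|a y z [ky ry] [kz rz]]; first by split; [exact: killed0|].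
  split=> [b bA|]; last by rewrite rl ry rz scaler0 addr0.
  by rewrite scalerDr kz // addr0; apply: (killedZ a ky).
(* Among the killed elements [K] is a complement of the boundaries, so [f j] is injective on it; [h]
   below extends the inverse to [E j.+1]. *)
pose K := propsub Kc.
pose g : {linear sub_module K -> E j.+1} := f j \o \val.
have ginj : injective g.
  move=> u v /= uv; apply: val_inj.
  have /propsubP[ku ru] := valP u; have /propsubP[kv rv] := valP v.
  apply/eqP; rewrite -subr_eq0; apply/eqP; rewrite -[LHS]rid ?rB ?ru ?rv ?subrr //.
  apply: (ac j ji); first exact: killedB.
  by rewrite linearB /= uv subrr.
have [h hg] := Einj (\val : {linear sub_module K -> E j}) ginj.
exists (fun y => f j (h y - rho (h y))); split.
- by move=> a y z; rewrite linearP rl opprD addrACA -scalerBr linearP.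
- move=> y ky; exists (h y - rho (h y)) => //.
  have khy : killed A (h y) by exact: killed_lin.
  by apply: killedB => //; apply: bd_killed; exact: rbd.
- move=> _ [y ky ->].
  have yK : y - rho y \in K.
    apply/propsubP; split; first by apply: killedB => //; apply/bd_killed/rbd.
    by rewrite rB (rid _ (rbd _ ky)) subrr.
  have fy : f j y = f j (y - rho y) by rewrite linearB /= (bd_cycle (rbd _ ky)) subr0.
  have hy : h (f j y) = y - rho y by rewrite fy; have := hg (Sub (y - rho y) yK).
  by rewrite hy rB (rid _ (rbd _ ky)) subrr subr0 -fy.
Qed.

Lemma cycle_closed A j : lin_closed (fun y : E j => killed A y /\ f j y = 0).
Proof.
split=> [|a y z [ky fy] [kz fz]]; first by split; [exact: killed0|exact: linear0].
split=> [b bA|]; last by rewrite linearP /= fy fz scaler0 addr0.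
by rewrite scalerDr kz // addr0; apply: (killedZ a ky).
Qed.
Definition cycle A j := propsub (@cycle_closed A j).

(* Baer's criterion for R / J; a map A / J -> R / J is given by any lift phi.  *)
Definition self_injective J := forall A (phi : R -> R), {subset J <= A} ->
  (forall a x y : R, x \in A -> y \in A -> phi (a * x + y) - (a * phi x + phi y) \in J) ->
  (forall a : R, a \in J -> phi a \in J) ->
  exists c : R, forall a : R, a \in A -> phi a - a * c \in J.

Section Selfinj.
Context {m J : ideal R} {n d : nat}.
Hypothesis noe : noetherian R.
Hypothesis loc : local m.
Hypothesis Jm : {subset J <= m}.
Hypothesis primeJ : forall P, prime_ideal P -> {subset J <= P} -> {subset m <= P}.
Hypothesis Eover : forall i, (n < i)%N -> forall x : E i, x = 0.
Hypothesis coh : cohomology_at J d.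

(** Downward induction on the degree: above [n] all terms vanish, and for [j >= d] the map [f j]
    takes the killed elements onto the cycles of degree [j.+1], where there is no cohomology. *)
Lemma cycle_baer j : (d <= j)%N -> baer J (cycle J j).
Proof.
move: {2}(n.+1 - j)%N (erefl (n.+1 - j)%N) => k; elim: k j => [|k IH] j kj dj.
  have nj : (n < j)%N by rewrite -subn_eq0 kj.
  move=> A _ phi _ _ _; exists 0; first exact: rpred0.
  by move=> a _; rewrite (Eover nj (phi a)) scaler0.
apply: (@baer_kernel _ m J noe loc Jm primeJ _ _ (f j) _ (cycle J j.+1)) => //.
- by apply/negP => /Jm; rewrite (negPf (local1 loc)).
- by move=> y; exact: propsubP.
- by move=> y ky; apply/propsubP; split; [exact: killed_lin|exact: ff].
- move=> y /propsubP[ky fy].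
  have jd : j.+1 != d by rewrite gtn_eqF.
  by have [y' ky' ->] := coh.1 _ jd y ky fy; exists y'.
- by apply: IH; [rewrite subnS kj|exact: leqW].
Qed.

(** The element [g' = g - rho g] spans a copy of [R / J] complementary to the boundaries among the
    cycles. A map to [R / J], followed by [a |-> a *: g'], is multiplication by a cycle [e]; the
    component of [e] along [g'] is the required scalar. *)
Lemma self_injective_of_cohomology : self_injective J.
Proof.
move=> A phi JA phil phiJ; have [ac [g [kg fg gen rel]]] := coh.
have acd j : (j < d)%N -> acyclic_at J j by move=> jd; apply: ac; rewrite ltn_eqF.
have [rho [rl rbd rid]] := boundary_retract acd (leqnn d).
pose g' := g - rho g.
have rB y z : rho (y - z) = rho y - rho z.
  by have := rl (-1) z y; rewrite !scaleN1r ![- _ + _]addrC.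
have r0 : rho 0 = 0 by rewrite rid //; exact: (bd_closed J d).1.
have rZ a y : rho (a *: y) = a *: rho y by rewrite -[a *: y]addr0 rl r0 addr0.
have kg' : killed J g' by apply: killedB => //; apply/bd_killed/rbd.
have cyc : g' \in cycle J d.
  apply/propsubP; split=> //.
  by rewrite linearB /= fg (bd_cycle (rbd _ kg)) subrr.
have [||a aJ|e /propsubP[ke fe] eP] := @cycle_baer d (leqnn d) A JA (fun a => phi a *: g').
- move=> a y z yA zA; rewrite scalerA -scalerDl.
  rewrite -[phi (a * y + z)](subrK (a * phi y + phi z)) [LHS]scalerDl [X in X + _]kg' ?add0r //.
  exact: phil.
- by move=> a _; apply: rpredZ.
- by rewrite kg' // phiJ.
have [c cb] := gen e ke fe; exists c => a aA; apply: rel.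
have re : e - rho e = c *: g'.
  have := rid _ cb; rewrite rB rZ => H.
  transitivity (rho e - c *: rho g + c *: g - rho e); first by rewrite H subrK.
  by rewrite [LHS]addrC !addrA addNr add0r addrC /g' scalerBr.
have -> : (phi a - a * c) *: g = rho ((phi a - a * c) *: g).
  have rg' : rho g' = 0 by rewrite rB (rid _ (rbd _ kg)) subrr.
  rewrite rZ; apply/eqP; rewrite -subr_eq0 -scalerBr -/g' scalerBl -scalerA -re.
  by rewrite (eP _ aA) -scalerBr subKr -rZ -(eP _ aA) rZ rg' scaler0.
by apply: rbd; exact: killedZ.
Qed.

End Selfinj.
End Complex.

(** * Duality in R / J *)

Section Gorenstein.
Context {R : comNzRingType}.
Implicit Types (A J Q m : ideal R).

Lemma parameter_sub_local m d (z : d.-tuple R) : noetherian R -> local m ->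
  regular_sequence z -> {subset ideal_gen z <= m}.
Proof. by move=> noe loc [z1 _]; exact: proper_sub_local. Qed.

(** A resolution of [R] has cohomology [R] in degree 0, generated by [e 1]; this starts the
    induction along [z]. *)
Lemma gorenstein_self_injective m d (z : d.-tuple R) : gorenstein_local m ->
  krull_dim R d -> regular_sequence z -> self_injective (ideal_gen z).
Proof.
move=> [noe loc [n [E [e [f [Einj Eover einj e0 fe]]]]]] dimR zreg.
have ff i x : f i.+1 (f i x) = 0 by apply/fe; exists x.
have zm := parameter_sub_local noe loc zreg.
apply: (@self_injective_of_cohomology R E f Einj ff m _ n d noe loc zm) => //.
  by move=> P Pp; exact: prime_over_parameters.
have dz : (d <= size z)%N by rewrite size_tuple.
have -> : ideal_gen z = ideal_gen (take d z) by rewrite take_oversize ?size_tuple.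
apply: (cohomology_regular Einj ff zreg dz).
have killed_nil (M : lmodType R) (y : M) : killed (ideal_gen ([::] : seq R)) y.
  by move=> a /ideal_genP[c ->]; rewrite big_ord0 scale0r.
have eE c : e c = c *: e 1 by rewrite -linearZ /= /GRing.scale /= mulr1.
split=> [j|].
  case: j => [//|j] _ y _ /fe[x ->] /=; exists x => //.
exists (e 1); split => //.
- by apply/e0; exists 1.
- by move=> y _ /e0[c ->]; exists c; rewrite /= eE subrr.
- move=> c /=; rewrite -eE -(linear0 e) => /einj ->; exact: (ideal0 (ideal_gen [::])).
Qed.

End Gorenstein.

Section Duality.
Context {R : comNzRingType} {m J : ideal R}.
Hypothesis noe : noetherian R.
Hypothesis loc : local m.
Hypothesis primeJ : forall P, prime_ideal P -> {subset J <= P} -> {subset m <= P}.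
Hypothesis Jm2 : {subset J <= ideal_exp m 2}.
Hypothesis Jinj : self_injective J.
Implicit Types (A Q : ideal R).

Lemma exp2_sub : {subset ideal_exp m 2 <= m}.
Proof. by apply: ideal_exp2_sub => a b am _; exact: idealMC. Qed.

(** Sending [Q] to 0 and each [x i] to [v i] is well defined modulo [J]: relations modulo [Q] have
    coefficients in [m], which kills the [v i]. By self-injectivity this map is multiplication by
    some [c]. *)
Lemma dual_functional Q k (x v : 'I_k -> R) : {subset J <= Q} ->
  (forall c : 'I_k -> R, \sum_i c i * x i \in Q -> forall i, c i \in m) ->
  (forall i a, a \in m -> a * v i \in J) ->
  exists c : R, (forall i, c * x i - v i \in J) /\ forall q : R, q \in Q -> c * q \in J.
Proof.
move=> JQ ind mv.
have Ac : lin_closed (fun y : R^o => exists b : 'I_k -> R, y - \sum_i b i * x i \in Q).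
  split=> [|a y z [b yb] [c zc]].
    by exists (fun=> 0); rewrite big1 ?subr0 ?ideal0 // => i _; rewrite mul0r.
  exists (fun i => a * b i + c i).
  have -> : a *: y + z - \sum_i (a * b i + c i) * x i =
            a * (y - \sum_i b i * x i) + (z - \sum_i c i * x i).
    rewrite /GRing.scale /= mulrBr addrACA -opprD mulr_sumr -big_split /=.
    by congr (_ - _); apply: eq_bigr => i _; rewrite mulrDl mulrA.
  by rewrite idealD // idealM.
pose A := propsub Ac.
have [b bP] : exists b : R -> 'I_k -> R, forall y, y \in A -> y - \sum_i b y i * x i \in Q.
  have /choice[b bP] y : exists b : 'I_k -> R, y \in A -> y - \sum_i b i * x i \in Q.
    have [yA|nyA] := pselect (y \in A); last by exists (fun=> 0).
    by have [b yb] := iffLR (propsubP Ac _) yA; exists b.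
  by exists b.
have mem_A (y : R) c : y - \sum_i c i * x i \in Q -> y \in A.
  by move=> yQ; apply/(propsubP Ac); exists c.
have bE (y : R) c : y - \sum_i c i * x i \in Q -> \sum_i b y i * v i - \sum_i c i * v i \in J.
  move=> yc; rewrite -sumrB; apply: ideal_sum => i _; rewrite -mulrBl; apply: mv.
  apply: (ind (fun i => b y i - c i)).
  have -> : \sum_i (b y i - c i) * x i = (y - \sum_i c i * x i) - (y - \sum_i b y i * x i).
    rewrite opprB addrC subrKA -sumrB; apply: eq_bigr => j _; exact: mulrBl.
  by apply: idealB => //; apply: bP; exact: mem_A yc.
have zero_sum (F : 'I_k -> R) : \sum_i 0 * F i = 0.
  by rewrite big1 // => i _; rewrite mul0r.
have sub0Q (q : R) : q \in Q -> q - \sum_i 0 * x i \in Q by rewrite zero_sum subr0.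
have sub0J (q : R) : q \in Q -> \sum_i b q i * v i \in J.
  by move=> qQ; have := bE q (fun=> 0) (sub0Q q qQ); rewrite zero_sum subr0.
have JA : {subset J <= A} by move=> q /JQ qQ; apply: (mem_A q (fun=> 0)); exact: sub0Q.
have [||c cP] := @Jinj A (fun y => \sum_i b y i * v i) JA.
- move=> a y z /bP yA /bP zA.
  have -> : a * \sum_i b y i * v i + \sum_i b z i * v i =
            \sum_i (a * b y i + b z i) * v i.
    by rewrite mulr_sumr -big_split; apply: eq_bigr => i _ /=; rewrite mulrDl mulrA.
  apply: bE.
  have -> : a * y + z - \sum_i (a * b y i + b z i) * x i =
            a * (y - \sum_i b y i * x i) + (z - \sum_i b z i * x i).
    rewrite mulrBr addrACA -opprD mulr_sumr -big_split /=.
    by congr (_ - _); apply: eq_bigr => i _; rewrite mulrDl mulrA.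
  by rewrite idealD // idealM.
- by move=> a /JQ; exact: sub0J.
exists c; split=> [i|q qQ].
  have xiQ : x i - \sum_j (j == i)%:R * x j \in Q by rewrite sum_delta subrr ideal0.
  have := bE _ _ xiQ; have := cP _ (mem_A _ _ xiQ); rewrite sum_delta.
  move=> h1 h2; have -> : c * x i - v i =
    (\sum_j b (x i) j * v j - v i) - (\sum_j b (x i) j * v j - x i * c) by ring.
  exact: idealB.
have qA : q \in A by apply: (mem_A q (fun=> 0)); exact: sub0Q.
rewrite mulrC -(subKr (\sum_i b q i * v i) (q * c)); apply: idealB; first exact: sub0J.
exact: cP.
Qed.

Section DualBasis.
Context {k : nat} {x : 'I_k -> R}.
Hypothesis gx : gens x m.
Hypothesis mx : minrel m x.
Local Notation I2 := (ideal_colon J (ideal_exp m 2)).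

Lemma colon2P (v : R) :
  v \in I2 <-> forall a b : R, a \in m -> b \in m -> v * (a * b) \in J.
Proof.
split=> [/asboolP vI a b am bm|vI]; first exact/vI/ideal_exp2_mem.
apply/asboolP; have vc : lin_closed (fun y : R^o => v * (y : R) \in J).
  split=> [|a y z vy vz]; first by rewrite mulr0 ideal0.
  by rewrite mulrDr idealD // mulrCA idealM.
suff H : {subset ideal_exp m 2 <= propsub vc} by move=> b /H/(propsubP vc).
by apply: ideal_exp2_sub => a b am bm; apply/(propsubP vc)/vI.
Qed.

Lemma exp2_gens (y : R) : y \in ideal_exp m 2 ->
  exists2 c : 'I_k -> R, forall i, c i \in m & y = \sum_i c i * x i.
Proof.
have Cc : lin_closed (fun y : R^o =>
    exists2 c : 'I_k -> R, forall i, c i \in m & y = \sum_i c i * x i).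
  split=> [|a _ _ [b bm ->] [c cm ->]].
    by exists (fun=> 0) => [i|]; rewrite ?ideal0 // big1 // => i _; rewrite mul0r.
  exists (fun i => a * b i + c i) => [i|]; first by rewrite idealD // idealM.
  rewrite /GRing.scale /= mulr_sumr -big_split; apply: eq_bigr => i _ /=.
  by rewrite mulrDl mulrA.
suff H : {subset ideal_exp m 2 <= propsub Cc} by move=> /H/(propsubP Cc).
apply: ideal_exp2_sub => a b am /gx[c ->]; apply/(propsubP Cc).
exists (fun i => a * c i) => [i|]; first exact: idealMC.
by rewrite mulr_sumr; apply: eq_bigr => i _; rewrite mulrA.
Qed.

Lemma gens_indep (c : 'I_k -> R) : \sum_i c i * x i \in ideal_exp m 2 ->
  forall i, c i \in m.
Proof.
move=> /exp2_gens[e em ce] i; rewrite -(subrK (e i) (c i)) idealD //.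
apply: (mx (c := fun i => c i - e i)).
by under eq_bigr do rewrite mulrBl; rewrite sumrB ce subrr.
Qed.

(* u spans the socle (J : m) / J of R / J, and w is dual to x for the product  *)
(* m / m^2 x (J : m^2) / (J : m) -> (J : m) / J.                               *)
Definition dual_basis (u : R) (w : 'I_k -> R) :=
  [/\ u \notin J, forall a : R, a \in m -> a * u \in J,
      forall i j, x i * w j - (i == j)%:R * u \in J,
      forall j, w j \in I2 &
      forall v : R, v \in I2 -> exists c (b : R), v - \sum_j c j * w j - b * u \in J].

(** The [w j] are the functionals on [m / m^2] dual to the basis [x], obtained with [Q = m^2]. They
    and [u] span: for [v] in [I2] each [x j * v] is a socle element [c j * u], and
    [v - \sum_j c j * w j] is then killed by [m]. *)
Lemma dual_basis_exists : exists u w, dual_basis u w.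
Proof.
have J1 : 1 \notin J by apply/negP => /Jm2/exp2_sub; rewrite (negPf (local1 loc)).
have [u uJ mu] := socle_nonzero noe primeJ (fun _ => id) J1.
(* The socle is spanned by [u], since the map [u |-> v] is a multiplication. *)
have socle v : (forall a : R, a \in m -> a * v \in J) -> exists b, v - b * u \in J.
  move=> mv; have [|_ a|b [bu _]] :=
    @dual_functional J 1 (fun=> u) (fun=> v) (fun _ => id).
  - by move=> c; rewrite big_ord1 => cu i; rewrite ord1; exact: (local_colon noe loc cu).
  - exact: mv.
  by exists b; rewrite -opprB; apply: idealN; exact: bu ord0.
have /choice[w wP] j : exists w : R, (forall i, w * x i - (i == j)%:R * u \in J) /\
    forall q : R, q \in ideal_exp m 2 -> w * q \in J.
  apply: dual_functional => //; first exact: gens_indep.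
  by move=> i a am; rewrite mulrCA idealM // mu.
exists u, w; split=> //.
- by move=> i j; rewrite mulrC; exact: (wP j).1.
- by move=> j; apply/colon2P => a b am bm; apply/(wP j).2/ideal_exp2_mem.
move=> v /colon2P vI.
have /choice[c cP] j : exists b, x j * v - b * u \in J.
  apply: socle => a am; have -> : a * (x j * v) = v * (a * x j) by ring.
  by apply: vI => //; exact: gens_mem gx.
exists c; apply: socle => _ /gx[e ->]; rewrite mulr_suml; apply: ideal_sum => i _.
rewrite -mulrA; apply: idealM.
have -> : x i * (v - \sum_j c j * w j) =
    (x i * v - c i * u) - \sum_j c j * (x i * w j - (i == j)%:R * u).
  under [X in _ = _ - X]eq_bigr do rewrite mulrBr.
  have E : \sum_j c j * ((i == j)%:R * u) = c i * u.
    rewrite -[in RHS](sum_delta c i) mulr_suml; apply: eq_bigr => j _.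
    by rewrite eq_sym; ring.
  rewrite sumrB E mulrBr mulr_sumr.
  by under [X in _ - X = _]eq_bigr do rewrite mulrCA; ring.
apply: idealB => //; apply: ideal_sum => j _; apply: idealM.
by rewrite [x i * w j]mulrC; exact: (wP j).1.
Qed.

End DualBasis.
End Duality.

(** * Lengths of the syzygy modules over R / J *)

Section Counting.
Context {R : comNzRingType} {m J : ideal R}.
Hypothesis noe : noetherian R.
Hypothesis loc : local m.
Context {k : nat} {x : 'I_k -> R} {u : R} {w : 'I_k -> R}.
Hypothesis gx : gens x m.
Hypothesis mx : minrel m x.
Hypothesis db : @dual_basis R m J k x u w.
Local Notation I2 := (ideal_colon J (ideal_exp m 2)).
Local Notation U := (add1_sub J u).
Local Notation free := {ffun 'I_k -> R^o}.

Let uJ : u \notin J. Proof. by have [] := db. Qed.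
Let mu a : a \in m -> a * u \in J. Proof. by have [_ + _ _ _] := db; apply. Qed.
Let xw i j : x i * w j - (i == j)%:R * u \in J. Proof. by have [_ _ + _ _] := db; apply. Qed.
Let wI j : w j \in I2. Proof. by have [_ _ _ + _] := db; apply. Qed.
Let I2gen (v : R) : v \in I2 -> exists c b, v - \sum_j c j * w j - b * u \in J.
Proof. by have [_ _ _ _ +] := db; apply. Qed.

Let xm i : x i \in m. Proof. exact: gens_mem gx. Qed.

Let m1 : ilen m (top_sub R^o) 1. Proof. exact/ilen_maximal/loc.1. Qed.

Let subtop (V : lmodType R) (N : submodule V) : {subset N <= top_sub V}.
Proof. by move=> v _; exact: in_top. Qed.

Lemma memU (y : R) : y \in U <-> exists b, y - b * u \in J.
Proof. exact: (propsubP (add1_closed J u)). Qed.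

Lemma dual_basis_mul (a : R) j : a \in m -> a * w j \in U.
Proof.
move=> /gx[e ->]; apply/memU; exists (e j).
have -> : (\sum_i e i * x i) * w j - e j * u = \sum_i e i * (x i * w j - (i == j)%:R * u).
  under [RHS]eq_bigr do rewrite mulrBr mulrA; rewrite sumrB -mulr_suml; congr (_ - _).
  by rewrite -(sum_delta e j) mulr_suml; apply: eq_bigr => i _; ring.
by apply: ideal_sum => i _; exact: idealM.
Qed.

(** Modulo [J], multiplication by [x i] leaves only [c i * u]. *)
Lemma dual_basis_indep (c : 'I_k -> R) : \sum_j c j * w j \in U -> forall i, c i \in m.
Proof.
move=> /memU[b cb] i; apply: (local_colon noe loc _ uJ).
have -> : c i * u = x i * (\sum_j c j * w j - b * u) + b * (x i * u)
    - \sum_j c j * (x i * w j - (i == j)%:R * u).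
  under [X in _ = _ - X]eq_bigr do rewrite mulrBr.
  have E : \sum_j c j * ((i == j)%:R * u) = c i * u.
    rewrite -[in RHS](sum_delta c i) mulr_suml; apply: eq_bigr => j _.
    by rewrite eq_sym; ring.
  rewrite sumrB E mulrBr mulr_sumr.
  by under [X in _ = X - _ + _ - _]eq_bigr do rewrite mulrCA; ring.
apply: idealB; first by apply: idealD; apply: idealM => //; exact: mu.
by apply: ideal_sum => j _; exact: idealM.
Qed.

Lemma JU : {subset J <= U}. Proof. exact: sub_add1. Qed.

Lemma JI2 : {subset J <= I2}.
Proof. by move=> v vJ; apply/colon2P => a b _ _; exact: idealMC. Qed.

Lemma UI2 : {subset U <= I2}.
Proof.
move=> v /memU[b vb]; rewrite -(subrK (b * u) v); apply: idealD; first exact: JI2.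
by apply/idealM/colon2P => a c am _; rewrite mulrCA mulrC -mulrA mulrC -mulrA idealM // mu.
Qed.

Lemma ilen_J_U : ilen J U 1.
Proof.
have <- : #|{: unit}| = 1%N by exact: card_unit.
apply: (@ilen_span _ m R^o _ (fun=> u)) => //.
- exact: JU.
- by move=> _; exact: mem_add1.
- by move=> a _; exact: mu.
- move=> y /memU[a ya]; exists (fun=> a).
  by rewrite (bigD1 tt) //= big1 ?addr0 //; case.
- move=> c; rewrite (bigD1 tt) //= big1 ?addr0; last by case.
  by move=> cx [] ; apply: (local_colon noe loc cx uJ).
Qed.

Lemma ilen_U_I2 : ilen U I2 k.
Proof.
rewrite -[X in ilen _ _ X](card_ord k).
apply: (@ilen_span _ m R^o _ w) => //.
- exact: UI2.
- by move=> a j; exact: dual_basis_mul.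
- by move=> y /I2gen[c [b yb]]; exists c; apply/memU; exists b.
- exact: dual_basis_indep.
Qed.

Lemma ilen_J_I2 : ilen J I2 k.+1.
Proof. by rewrite -add1n; exact: ilen_add JU UI2 ilen_J_U ilen_U_I2. Qed.

Lemma ilen_m2_m : ilen (ideal_exp m 2) m k.
Proof.
rewrite -[X in ilen _ _ X](card_ord k).
apply: (@ilen_span _ m R^o _ x) => //.
- exact: exp2_sub.
- by move=> a j am; exact: ideal_exp2_mem.
- by move=> y /gx[c ->]; exists c; rewrite subrr; exact: ideal0.
- exact: gens_indep.
Qed.

Lemma ilen_m2_top : ilen (ideal_exp m 2) (top_sub R^o) k.+1.
Proof. by rewrite -[k.+1]addn1; refine (ilen_add (@exp2_sub _ m) (@subtop _ m) ilen_m2_m m1). Qed.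

(* With e_i the standard basis, \sum_(i, j) X i j *: (w_j e_i - w_i e_j) has    *)
(* i-th coordinate skew_sum X w i.                                             *)
Definition skew_sum r (X : 'I_r -> 'I_r -> R) (y : 'I_r -> R) (i : 'I_r) : R :=
  \sum_j (X i j - X j i) * y j.

Lemma syz_closed : lin_closed (fun q : free => \sum_j (q j : R) * w j \in J).
Proof.
split=> [|a q q' qJ q'J]; first by rewrite big1 ?ideal0 // => j _; rewrite ffunE mul0r.
have -> : \sum_j ((a *: q + q') j : R) * w j =
    a * (\sum_j (q j : R) * w j) + \sum_j (q' j : R) * w j.
  rewrite mulr_sumr -big_split; apply: eq_bigr => j _ /=.
  by rewrite !ffunE /GRing.scale /=; ring.
by rewrite idealD // idealM.
Qed.
(** The kernel of [w : (R / J)^k -> R / J], lifted to [R^k]; likewise [koszul_syz] below includes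
    all vectors with entries in [J]. *)
Definition syz := propsub syz_closed.

Lemma koszul_syz_closed : lin_closed (fun q : free =>
  exists X, forall i, (q i : R) - skew_sum X w i \in J).
Proof.
split=> [|a q q' [X XP] [Y YP]].
  exists (fun _ _ => 0) => i; have -> : skew_sum (fun _ _ => 0) w i = 0.
    by rewrite /skew_sum big1 // => j _; rewrite subrr mul0r.
  by rewrite ffunE subr0 ideal0.
exists (fun i j => a * X i j + Y i j) => i.
have -> : ((a *: q + q') i : R) - skew_sum (fun i j => a * X i j + Y i j) w i =
    a * (q i - skew_sum X w i) + (q' i - skew_sum Y w i).
  rewrite !ffunE {1}/GRing.scale /= mulrBr addrACA -opprD mulr_sumr -big_split /=.
  by congr (_ - _); apply: eq_bigr => j _; ring.
by rewrite idealD // idealM.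
Qed.
Definition koszul_syz := propsub koszul_syz_closed.

Lemma skew_sum0 r (X : 'I_r -> 'I_r -> R) y : \sum_i skew_sum X y i * y i = 0.
Proof.
under eq_bigr => i _ do rewrite /skew_sum mulr_suml; under eq_bigr => i _.
  under eq_bigr => j _ do rewrite -mulrA mulrBl; rewrite sumrB; over.
rewrite sumrB [X in _ - X]exchange_big /=; apply/eqP; rewrite subr_eq0; apply/eqP.
by apply: eq_bigr => i _; apply: eq_bigr => j _; rewrite [y j * _]mulrC.
Qed.

Lemma koszul_syz_sub : {subset koszul_syz <= syz}.
Proof.
move=> q /propsubP[X XP]; apply/propsubP.
have -> : \sum_j (q j : R) * w j = \sum_j (q j - skew_sum X w j) * w j.
  by under [RHS]eq_bigr do rewrite mulrBl; rewrite sumrB skew_sum0 subr0.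
by apply: ideal_sum => j _; exact: idealMC.
Qed.

Lemma ffun_sub_mono (A B : ideal R) : {subset A <= B} ->
  {subset ffun_sub 'I_k A <= ffun_sub 'I_k B}.
Proof. by move=> AB q /propsubP qA; apply/propsubP => i; exact: AB. Qed.

(* Since k >= 2, for each i there is j <> i, and modulo J the i-th unit vector *)
(* times u is x_j times the trivial relation between w_i and w_j.              *)
Lemma U_koszul_syz : (2 <= k)%N -> {subset ffun_sub 'I_k U <= koszul_syz}.
Proof.
move=> k2 q /propsubP qU; apply/propsubP.
have /choice[b bP] i : exists b : R, (q i : R) - b * u \in J by exact/memU.
have /choice[s sP] (i : 'I_k) : exists j, j != i.
  case: k k2 i => [|[|n]] // _ i; exists (lift i ord0); rewrite eq_sym; exact: neq_lift.
(* Besides [b i * (x (s i) * w (s i))], coordinate [i] receives only multiples of [x i * w j] with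
   [i != j], which lie in [J]. *)
exists (fun i j => (j == s i)%:R * (b i * x j)) => i; rewrite /skew_sum.
have -> : \sum_j ((j == s i)%:R * (b i * x j) - (i == s j)%:R * (b j * x i)) * w j =
    b i * (x (s i) * w (s i)) - \sum_j (i == s j)%:R * (b j * (x i * w j)).
  under eq_bigr do rewrite mulrBl; rewrite sumrB; congr (_ - _).
    rewrite -[RHS](sum_delta (fun j => b i * (x j * w j))); apply: eq_bigr => j _.
    by rewrite !mulrA.
  by apply: eq_bigr => j _; rewrite !mulrA.
have -> : (q i : R) - (b i * (x (s i) * w (s i)) - \sum_j (i == s j)%:R * (b j * (x i * w j)))
  = (q i - b i * u) - b i * (x (s i) * w (s i) - (s i == s i)%:R * u)
    + \sum_j (i == s j)%:R * (b j * (x i * w j)) by rewrite eqxx mul1r; ring.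
apply: idealD; first by apply: idealB; rewrite ?idealM.
apply: ideal_sum => j _; have [->|_] := eqVneq i (s j); last by rewrite mul0r ideal0.
rewrite mul1r; apply: idealM.
by have := xw (s j) j; rewrite (negPf (sP j)) mul0r subr0.
Qed.

Lemma ilen_J_U_ffun : ilen (ffun_sub 'I_k J) (ffun_sub 'I_k U) k.
Proof.
rewrite -[X in ilen _ _ X](card_ord k).
pose e (t : 'I_k) : free := [ffun i => (t == i)%:R * u].
have eE (c : 'I_k -> R) i : (\sum_t c t *: e t) i = c i * u.
  rewrite sum_ffunE -[in RHS](sum_delta c i) mulr_suml; apply: eq_bigr => t _.
  by rewrite !ffunE /GRing.scale /=; ring.
apply: (@ilen_span _ m free _ e) => //.
- exact/ffun_sub_mono/JU.
- move=> t; apply/propsubP => i; rewrite ffunE; apply: idealM; exact: mem_add1.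
- move=> a t am; apply/propsubP => i; rewrite !ffunE /GRing.scale /=.
  by rewrite mulrCA idealM // mu.
- move=> y /propsubP yU.
  have /choice[c cP] i : exists b : R, (y i : R) - b * u \in J by exact/memU.
  by exists c; apply/propsubP => i; rewrite !ffunE eE.
- move=> c /propsubP cJ t; apply: (local_colon noe loc _ uJ).
  by have := cJ t; rewrite eE.
Qed.

Let pairs : {pred 'I_k * 'I_k} := fun p => (p.1 < p.2)%N.

Lemma card_pairs : #|{: {p | p \in pairs}}| = 'C(k, 2).
Proof.
rewrite card_sig -sum1_card -[RHS]triangular_sum big_mkord.
rewrite big_mkcond /= -(pair_bigA _ (fun i j : 'I_k => if (i < j)%N then 1%N else 0%N)).
rewrite exchange_big /=; apply: eq_bigr => j _.
rewrite -big_mkcond /= -(big_ord_widen _ (fun=> 1%N) (ltnW (ltn_ord j))).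
by rewrite sum1_card card_ord.
Qed.

(** The trivial relations [w_i e_j - w_j e_i] with [i < j] form a basis over [R / m]: [m] sends
    every [w j] into [U], and each coordinate of a combination is a sum to which [dual_basis_indep]
    applies. *)
Lemma ilen_U_koszul_syz : (2 <= k)%N -> ilen (ffun_sub 'I_k U) koszul_syz 'C(k, 2).
Proof.
move=> k2; rewrite -card_pairs.
pose e (p : 'I_k * 'I_k) : free := [ffun l => (p.2 == l)%:R * w p.1 - (p.1 == l)%:R * w p.2].
have eE (c : 'I_k * 'I_k -> R) l : (\sum_(t : {p | p \in pairs}) c (val t) *: e (val t)) l =
    \sum_(j < k) ((j < l)%N%:R * c (j, l) - (l < j)%N%:R * c (l, j)) * w j.
  rewrite -(big_sub pairs (fun p => c p *: e p)) sum_ffunE big_mkcond /=.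
  pose F (i j : 'I_k) : R := (i < j)%N%:R *
    (c (i, j) * ((j == l)%:R * w i - (i == l)%:R * w j)).
  transitivity (\sum_p F p.1 p.2).
    apply: eq_bigr => -[i j] _; rewrite unfold_in /F /= !ffunE /=.
    by case: ltnP => _; rewrite ?mul1r ?mul0r.
  rewrite -(pair_bigA _ F) /=.
  transitivity (\sum_(i < k) \sum_(j < k) (j == l)%:R * ((i < j)%N%:R * (c (i, j) * w i))
    - \sum_(j < k) \sum_(i < k) (i == l)%:R * ((i < j)%N%:R * (c (i, j) * w j))).
    rewrite [X in _ - X]exchange_big /= -sumrB; apply: eq_bigr => i _.
    by rewrite -sumrB; apply: eq_bigr => j _; rewrite /F; ring.
  rewrite -sumrB; apply: eq_bigr => j _.
  rewrite (sum_delta (fun t : 'I_k => (j < t)%N%:R * (c (j, t) * w j))).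
  by rewrite (sum_delta (fun t : 'I_k => (t < j)%N%:R * (c (t, j) * w j))); ring.
have eS (c : {p | p \in pairs} -> R) : exists c' : 'I_k * 'I_k -> R,
    forall t, c t = c' (val t).
  exists (fun p => if insub p is Some t then c t else 0) => t.
  by rewrite valK.
apply: (@ilen_span _ m free _ (fun t : {p | p \in pairs} => e (val t))) => //.
- exact: U_koszul_syz.
- move=> [[i j] ij]; apply/propsubP => /=.
  exists (fun a b => (a == j)%:R * (b == i)%:R) => l; rewrite ffunE /= /skew_sum.
  have -> : \sum_b ((l == j)%:R * (b == i)%:R - (b == j)%:R * (l == i)%:R) * w b =
     (j == l)%:R * w i - (i == l)%:R * w j.
    rewrite -[w i](sum_delta w) -[w j](sum_delta w) !mulr_sumr -sumrB.
    by apply: eq_bigr => b _; rewrite [j == l]eq_sym [i == l]eq_sym; ring.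
  by rewrite subrr ideal0.
- move=> a [[i j] ij] am; apply/propsubP => l; rewrite !ffunE /GRing.scale /=.
  rewrite mulrBr ![a * (_%:R * _)]mulrCA.
  apply: (@idealB _ U); apply: (@idealM _ U);
  exact: dual_basis_mul.
- move=> y /propsubP[X XP].
  (* The indices are swapped because [e (i, j)] is the negative of the relation that [skew_sum]
     weights by [X i j]. *)
  exists (fun t => X (val t).2 (val t).1 - X (val t).1 (val t).2).
  apply/ffun_sub_mono; first exact: JU.
  apply/propsubP => l; have := XP l.
  rewrite !ffunE (eE (fun p => X p.2 p.1 - X p.1 p.2)) /=; congr (_ - _ \in J).
  apply: eq_bigr => j _; congr (_ * _).
  by case: ltngtP => [_|_|/val_inj->]; rewrite ?mul1r ?mul0r ?subrr //; ring.
- move=> c; have [c' cc'] := eS c; under eq_bigr do rewrite cc'.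
  move=> /propsubP cU [[i j] ij]; rewrite cc' /=.
  have := cU j; rewrite eE => /dual_basis_indep /(_ i).
  have {}ij : (i < j)%N by [].
  by rewrite ij ltnNge (ltnW ij) /= mul1r mul0r subr0.
Qed.

(** The map [w] sends [R^k] onto [I2 / J], as [u] is [x o * w o] modulo [J], and its kernel is
    [syz]. *)
Lemma ilen_syz_top : (0 < k)%N -> ilen syz (top_sub free) k.+1.
Proof.
move=> k0; refine (ilen_pull (f := fun q : free => \sum_j (q j : R) * w j)
  (W := R^o) _ _ _ _ _ _ ilen_J_I2).
- move=> a q q'; rewrite /GRing.scale /= mulr_sumr -big_split; apply: eq_bigr => j _ /=.
  by rewrite !ffunE /GRing.scale /=; ring.
- exact: subtop.
- exact: JI2.
- by move=> q _; apply: ideal_sum => j _; apply: idealM.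
- move=> v /I2gen[c [b vb]]; pose o := Ordinal k0.
  exists [ffun j => c j + (j == o)%:R * (b * x o)]; first exact: in_top.
  have -> : \sum_j ([ffun j => c j + (j == o)%:R * (b * x o)] j : R) * w j =
      \sum_j c j * w j + b * (x o * w o).
    rewrite -(sum_delta (fun j => b * (x o * w j))) -big_split; apply: eq_bigr => j _ /=.
    by rewrite ffunE; ring.
  have -> : \sum_j c j * w j + b * (x o * w o) - v =
      b * (x o * w o - (o == o)%:R * u) - (v - \sum_j c j * w j - b * u).
    by rewrite eqxx mul1r; ring.
  by apply: idealB => //; exact: idealM.
- by move=> q _; apply/idP/idP => [qJ|/propsubP //]; apply/propsubP.
Qed.

(** The steps below, between and above the two syzygy modules fill [R^k] over its vectors with
    entries in [J], and [k + 'C(k, 2) = 'C(k.+1, 2)]. *)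
Lemma ilen_koszul_syz l : (2 <= k)%N -> ilen I2 (top_sub R^o) l ->
  exists2 h, ilen koszul_syz syz h & (h + 'C(k.+1, 2) + k.+1 = k * (k.+1 + l))%N.
Proof.
move=> k2 I2l.
have Jl := ilen_add JI2 (@subtop _ I2) ilen_J_I2 I2l.
have Jk := ilen_ffun 'I_k Jl; rewrite card_ord in Jk.
have JkB : {subset ffun_sub 'I_k J <= koszul_syz}.
  by move=> q /(ffun_sub_mono JU); exact: U_koszul_syz.
have [h Bh] := ilen_sub JkB koszul_syz_sub (@subtop _ syz) Jk.
exists h => //.
have H1 := ilen_add (ffun_sub_mono JU) (U_koszul_syz k2) ilen_J_U_ffun (ilen_U_koszul_syz k2).
have H2 := ilen_add JkB koszul_syz_sub H1 Bh.
have H3 := ilen_add _ (@subtop _ syz) H2 (ilen_syz_top (ltnW k2)).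
rewrite (ilen_uniq Jk (H3 _)); last by move=> q /JkB/koszul_syz_sub.
by rewrite binS bin1; lia.
Qed.

End Counting.
Arguments syz {R} J {k} w.
Arguments koszul_syz {R} J {k} w.

(** * Koszul cycles and boundaries in degree one *)

Section ColumnKoszul.
Context {R : comNzRingType}.
Implicit Types (A m J : ideal R).

Lemma cycles_col_closed r (a : 'cV[R]_r) : lin_closed (fun v : 'cV[R]_r => a^T *m v = 0).
Proof.
by split=> [|c v w av aw]; rewrite ?mulmx0 // mulmxDr -scalemxAr av aw scaler0 addr0.
Qed.
Definition cycles_col r (a : 'cV[R]_r) := propsub (cycles_col_closed a).

(* Alternating matrices are exactly the X - X^T, also in characteristic 2.     *)
Lemma boundaries_col_closed r (a : 'cV[R]_r) :
  lin_closed (fun v : 'cV[R]_r => exists X : 'M_r, v = (X - X^T) *m a).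
Proof.
split=> [|c _ _ [X ->] [Y ->]]; first by exists 0; rewrite trmx0 subrr mul0mx.
exists (c *: X + Y); rewrite linearP /= scalemxAl -mulmxDl; congr (_ *m a).
by rewrite scalerBr opprD addrACA.
Qed.
Definition boundaries_col r (a : 'cV[R]_r) := propsub (boundaries_col_closed a).

Lemma tr_mx11 (M : 'M[R]_1) : M^T = M.
Proof. by rewrite [M]mx11_scalar tr_scalar_mx. Qed.

Lemma skew_form0 r (X : 'M[R]_r) (a : 'cV[R]_r) : a^T *m ((X - X^T) *m a) = 0.
Proof.
rewrite mulmxA mulmxBr mulmxBl -[a^T *m X *m a]tr_mx11 !trmx_mul trmxK mulmxA.
exact: subrr.
Qed.

Lemma skew_congr r s (X : 'M[R]_s) (P : 'M_(s, r)) :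
  P^T *m (X - X^T) *m P = P^T *m X *m P - (P^T *m X *m P)^T.
Proof. by rewrite !trmx_mul trmxK mulmxBr mulmxBl !mulmxA. Qed.

Lemma boundaries_cycles_col r (a : 'cV[R]_r) : {subset boundaries_col a <= cycles_col a}.
Proof. by move=> v /propsubP[X ->]; apply/propsubP; exact: skew_form0. Qed.

(** The map [v |-> P^T *m v] takes cycles on [b] to cycles on [a]; boundaries correspond because
    congruence preserves alternating matrices. *)
Lemma ilen_change_gens r s (a : 'cV[R]_r) (b : 'cV[R]_s) P L h :
  L *m P = 1%:M -> P *m L = 1%:M -> b = P *m a ->
  ilen (boundaries_col b) (cycles_col b) h -> ilen (boundaries_col a) (cycles_col a) h.
Proof.
move=> LP PL bP; have La : a = L *m b by rewrite bP mulmxA LP mul1mx.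
apply: (ilen_push (f := fun v : 'cV_s => P^T *m v)).
- by move=> c v w; rewrite mulmxDr -scalemxAr.
- exact: boundaries_cycles_col.
- exact: boundaries_cycles_col.
- by move=> v /propsubP bv; apply/propsubP; rewrite mulmxA -trmx_mul -bP.
- move=> y /propsubP ay; exists (L^T *m y).
    by apply/propsubP; rewrite mulmxA -trmx_mul -La.
  by rewrite mulmxA -trmx_mul LP trmx1 mul1mx subrr rpred0.
- move=> v _; apply/idP/idP => /propsubP[X]; last first.
    move=> ->; apply/propsubP; exists (P^T *m X *m P).
    by rewrite -skew_congr bP !mulmxA.
  move=> PX; apply/propsubP; exists (L^T *m X *m L).
  have -> : v = L^T *m (P^T *m v) by rewrite mulmxA -trmx_mul PL trmx1 mul1mx.
  by rewrite PX La -skew_congr !mulmxA.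
Qed.

Lemma det_cong m r (X Y : 'M[R]_r) : (forall i j, X i j - Y i j \in m) ->
  \det X - \det Y \in m.
Proof.
move=> XY; rewrite -sumrB; apply: ideal_sum => s _; rewrite -mulrBr; apply: idealM.
elim/big_ind2: _ => [|a b c e ab ce|i _]; first by rewrite subrr ideal0.
  have -> : b * e - a * c = e * (b - a) + a * (e - c) by ring.
  by rewrite idealD // idealM.
exact: XY.
Qed.

Lemma left_inverse_cong1 m r (X : 'M[R]_r) : noetherian R -> local m ->
  (forall i j, X i j - (i == j)%:R \in m) -> exists Y, Y *m X = 1%:M.
Proof.
move=> noe loc X1; have [|y yX] := local_unit noe loc (x := \det X).
  apply/negP => dX; case/negP: (local1 loc).
  rewrite -(subKr (\det X) 1) idealB // -(det1 R r); apply: det_cong => i j.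
  by rewrite mxE.
by exists (y *: \adj X); rewrite -scalemxAl mul_adj_mx scale_scalar_mx yX.
Qed.

(** Write [b = P *m a] and [a = Q *m b]; by minimality [Q *m P] and [P *m Q] are the identity modulo
    [m], hence invertible. As [r] and [s] may differ a priori, both one-sided inverses are
    established. *)
Lemma gens_change m A r s (a : 'cV[R]_r) (b : 'cV[R]_s) : noetherian R -> local m ->
  gens (fun i => a i 0) A -> minrel m (fun i => a i 0) ->
  gens (fun i => b i 0) A -> minrel m (fun i => b i 0) ->
  exists P L, [/\ L *m P = 1%:M, P *m L = 1%:M & b = P *m a].
Proof.
move=> noe loc.
have base p q (c : 'cV[R]_p) (e : 'cV[R]_q) : gens (fun i => c i 0) A ->
    gens (fun i => e i 0) A -> exists P, e = P *m c.
  move=> gc ge; have /choice[P PE] i : exists P : 'I_p -> R, e i 0 = \sum_j P j * c j 0.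
    by apply/gc; exact: (gens_mem i ge).
  exists (\matrix_(i, j) P i j); apply/matrixP => i j; rewrite ord1 PE mxE.
  by apply: eq_bigr => l _; rewrite mxE.
have inv p (c : 'cV[R]_p) X : minrel m (fun i => c i 0) -> c = X *m c ->
    exists Y, Y *m X = 1%:M.
  move=> mc cX; apply: left_inverse_cong1 noe loc _ => i j.
  apply: (mc (fun j => X i j - (i == j)%:R)).
  under eq_bigr do rewrite mulrBl eq_sym; rewrite sumrB sum_delta.
  by rewrite {2}cX mxE subrr.
move=> ga ma gb mb; have [P bP] := base _ _ a b ga gb; have [Q aQ] := base _ _ b a gb ga.
have [|Y YQP] := inv _ a (Q *m P) ma; first by rewrite -mulmxA -bP.
have [|Y' YPQ] := inv _ b (P *m Q) mb; first by rewrite -mulmxA -aQ.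
exists P, (Y *m Q); split=> //; first by rewrite -mulmxA.
have QYP : Q *m (P *m (Y *m Q)) = Q *m 1%:M.
  by rewrite mulmx1 !mulmxA (mulmx1C YQP) mul1mx.
have := congr1 (mulmx (Y' *m P)) QYP.
by rewrite !mulmxA -[Y' *m P *m Q]mulmxA YPQ !mul1mx.
Qed.

(** Induction on the number of leading coordinates that support [p]. By regularity the last of them
    is a combination of the earlier [z_j], so a trivial syzygy removes it. This is the vanishing of
    the first Koszul homology. *)
Lemma regular_syzygies d (z : d.-tuple R) (p : 'cV[R]_d) : regular_sequence z ->
  (\col_i z`_i)^T *m p = 0 -> exists W : 'M_d, p = (W - W^T) *m \col_i z`_i.
Proof.
move=> [_ zreg]; set zeta := \col_i z`_i => zp.
suff H i : (i <= d)%N -> forall p : 'cV[R]_d, (forall j : 'I_d, (i <= j)%N -> p j 0 = 0) ->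
    zeta^T *m p = 0 -> exists W : 'M_d, p = (W - W^T) *m zeta.
  by apply: (H d (leqnn d) p _ zp) => j; rewrite leqNgt ltn_ord.
elim: i => [|i IH] id {zp}p p0 zp.
  exists 0; rewrite trmx0 subrr mul0mx; apply/matrixP => j l.
  by rewrite ord1 p0 ?mxE.
pose o := Ordinal id.
have sz : size (take i z) = i by rewrite size_takel ?size_tuple // ltnW.
have [c cE] : exists c : nat -> R, p o 0 = \sum_(j < d | (j < i)%N) c j * z`_j.
  have : p o 0 \in ideal_gen (take i z).
    apply: zreg; first by rewrite size_tuple.
    have : z`_i * p o 0 = - \sum_(j < d | (j < i)%N) p j 0 * z`_j.
      have := congr1 (fun M : 'M_1 => M 0 0) zp; rewrite !mxE.
      rewrite (bigID (fun j : 'I_d => (j < i)%N)) /= [X in _ + X](bigD1 o) /=; last first.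
        by rewrite ltnn.
      rewrite [X in _ + (_ + X)]big1 ?addr0 => [|j /andP[ji jo]]; last first.
        rewrite p0 ?mulr0 // ltn_neqAle leqNgt ji andbT.
        by apply: contraNneq jo => ij; apply/eqP/val_inj.
      move=> /eqP; rewrite addrC !mxE addr_eq0 => /eqP ->; congr (- _).
      by apply: eq_bigr => j _; rewrite !mxE mulrC.
    move=> ->; apply: idealN; apply: ideal_sum => j ji; apply: idealM.
    by apply: ideal_gen_mem; rewrite -(nth_take 0 ji) mem_nth ?sz.
  move=> /ideal_genP[c ->]; exists c; rewrite sz.
  rewrite (big_ord_widen_cond d predT (fun j => c j * (take i z)`_j)); last exact: ltnW.
  by apply: eq_big => // j ji; rewrite nth_take.
(* Only row [o] is nonzero; [X - X^T] produces [p o 0] at [o] and otherwise affects only the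
   coordinates below [i]. *)
pose X : 'M[R]_d := \matrix_(l, j) ((l == o)%:R * ((j < i)%N%:R * c j)).
have XE l : ((X - X^T) *m zeta) l 0 = (l == o)%:R * p o 0 - (l < i)%N%:R * c l * z`_i.
  rewrite mulmxBl !mxE; congr (_ - _).
    rewrite cE mulr_sumr [RHS]big_mkcond /=; apply: eq_bigr => j _; rewrite !mxE.
    by case: ifP => _; rewrite ?mul1r ?mul0r ?mulr0 ?mul0r // mulrA.
  have <- := sum_delta (fun j : 'I_d => (l < i)%N%:R * c l * z`_j) o.
  by apply: eq_bigr => j _; rewrite !mxE !mulrA.
have [||W WE] := IH (ltnW id) (p - (X - X^T) *m zeta).
- move=> j ij; rewrite mxE [X in _ + X]mxE XE [(j < i)%N]ltnNge ij /= !mul0r subr0.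
  have [->|jo] := eqVneq j o; first by rewrite mul1r subrr.
  rewrite mul0r subr0 p0 // ltn_neqAle ij andbT.
  by apply: contraNneq jo => ij'; apply/eqP/val_inj.
- by rewrite mulmxBr zp skew_form0 subrr.
exists (W + X); rewrite -(subrK ((X - X^T) *m zeta) p) WE -mulmxDl; congr (_ *m _).
by rewrite linearD /= opprD addrACA.
Qed.

End ColumnKoszul.

Section KoszulColumns.
Context {R : comNzRingType} {r : nat}.
Implicit Types (g : koszul R r) (a : r.-tuple R).

Lemma koszul_degP p g :
  g \in koszul_deg p <-> forall S : {set 'I_r}, #|S| != p -> g S = 0.
Proof.
split=> [/forallP H S|H]; last first.
  by apply/forallP => S; apply/implyP; apply: contraNT => /H ->.
by move=> Sp; apply/eqP; apply: contraNT Sp; exact/implyP.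
Qed.

Definition tuple_col a : 'cV[R]_r := \col_i a`_i.

Lemma koszul_diff_set0 a g :
  koszul_diff a g finset.set0 = \sum_(i < r) a`_i * g [set i]%SET.
Proof.
rewrite ffunE; apply: eq_big => [i|i _]; first by rewrite inE.
rewrite finset.setU0 (tnth_nth 0); set s := finset _.
have -> : s = finset.set0 by apply/setP => j; rewrite !inE.
by rewrite cards0 expr0 mul1r.
Qed.

Lemma koszul_diff_set1 a g l : koszul_diff a g [set l]%SET =
  \sum_(i < r | i != l) (-1) ^+ (l < i)%N * a`_i * g [set i; l]%SET.
Proof.
rewrite ffunE; apply: eq_big => [i|i _]; first by rewrite inE.
rewrite (tnth_nth 0); congr (_ ^+ _ * _ * _).
case: (ltnP l i) => li; last first.
  apply/eqP; rewrite cards_eq0; apply/eqP/setP => j; rewrite !inE.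
  by case: eqP => // ->; rewrite ltnNge li.
rewrite -[RHS](cards1 l); apply: eq_card => j; rewrite !inE.
by case: eqP => // ->; rewrite li.
Qed.

Lemma koszul_diff_deg a p g : g \in koszul_deg p.+1 -> koszul_diff a g \in koszul_deg p.
Proof.
move=> /koszul_degP gp; apply/koszul_degP => S Sp; rewrite ffunE big1 // => i iS.
by rewrite gp ?mulr0 // cardsU1 iS.
Qed.

Lemma koszul_boundaries_cycles a p :
  {subset koszul_boundaries a p <= koszul_cycles a p}.
Proof.
move=> _ /asboolP[g gp ->]; apply/andP; split; first exact: koszul_diff_deg.
by rewrite koszul_diffK.
Qed.

Lemma set2_lt_inj (i j k l : 'I_r) : (i < j)%N -> (k < l)%N ->
  [set i; j]%SET = [set k; l]%SET -> (i, j) = (k, l).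
Proof.
move=> ij kl /setP E; have := E i; have := E j; rewrite !inE !eqxx orbT /=.
move=> /esym/orP[] /eqP jE /esym/orP[] /eqP iE; rewrite ?iE ?jE //.
- by move: ij; rewrite iE jE ltnn.
- by move: ij; rewrite iE jE ltnNge (ltnW kl).
- by move: ij; rewrite iE jE ltnn.
Qed.

Definition koszul_col g : 'cV[R]_r := \col_i g [set i]%SET.

(** Reading off coefficients at singletons identifies degree one with columns; coefficients at
    two-element sets become the entries of an alternating matrix. *)
Lemma ilen_koszul1 a h :
  is_length (koszul_homology a 1) h <->
  ilen (boundaries_col (tuple_col a)) (cycles_col (tuple_col a)) h.
Proof.
apply: (iff_trans (is_length_subquotient _ (@koszul_boundaries_cycles a 1))).
have colE g : ((tuple_col a)^T *m koszul_col g) = (koszul_diff a g finset.set0)%:M.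
  rewrite koszul_diff_set0; apply/matrixP => i j; rewrite !ord1 !mxE eqxx mulr1n.
  by apply: eq_bigr => l _; rewrite !mxE.
have cycE g : g \in koszul_deg 1 ->
    g \in koszul_cycles a 1 <-> (tuple_col a)^T *m koszul_col g = 0.
  move=> g1; rewrite colE; split=> [/andP[_ /eqP->]|H]; first by rewrite ffunE raddf0.
  apply/andP; split=> //; apply/eqP/ffunP => S; rewrite [RHS]ffunE.
  have [/cards0_eq->|S0] := eqVneq #|S| 0%N; last first.
    by have /koszul_degP := koszul_diff_deg a g1; apply.
  by have := congr1 (fun M : 'M_1 => M 0 0) H; rewrite !mxE eqxx mulr1n.
apply: (ilen_map _ (f := koszul_col)).
- move=> c f g; apply/matrixP => i j; rewrite !mxE !ffunE //.
- exact: koszul_boundaries_cycles.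
- exact: boundaries_cycles_col.
- by move=> g gZ; apply/propsubP/cycE => //; case/andP: gZ.
- move=> v /propsubP av.
  pose g : koszul R r := [ffun S => \sum_i (S == [set i]%SET)%:R * v i 0].
  have gv : koszul_col g = v.
    apply/matrixP => i j; rewrite ord1 !mxE ffunE -[RHS](sum_delta (fun i => v i 0)).
    by apply: eq_bigr => l _; rewrite (inj_eq (@finset.set1_inj _)) eq_sym.
  have g1 : g \in koszul_deg 1.
    apply/koszul_degP => S S1; rewrite ffunE big1 // => i _.
    have [SE|_] := eqVneq S [set i]%SET; last by rewrite mul0r.
    by move: S1; rewrite SE cards1.
  exists g; first by apply/cycE => //; rewrite gv.
  by rewrite gv subrr rpred0.
move=> x /andP[x1 _]; apply/idP/idP; last first.
  move=> /asboolP[g _ ->]; apply/propsubP.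
  (* Filling only the entries with [l < i] lets [X - X^T] reproduce each coefficient with the sign
     of the differential. *)
  exists (\matrix_(l, i) (if (l < i)%N then - g [set i; l]%SET else 0)).
  apply/matrixP => l j; rewrite ord1 !mxE koszul_diff_set1 big_mkcond /=.
  apply: eq_bigr => i _; rewrite !mxE -val_eqE /=.
  case: ltngtP => [il|li|il] /=; rewrite ?subr0 ?sub0r ?opprK ?subrr ?mul0r //.
    by rewrite expr1 mulN1r !mulNr mulrC.
  by rewrite expr0 mul1r finset.setUC mulrC.
move=> /propsubP[X xX]; apply/asboolP.
pose g : koszul R r := [ffun S : {set 'I_r} => - \sum_(p : 'I_r * 'I_r |
  (p.1 < p.2)%N && (S == [set p.1; p.2]%SET)) (X p.1 p.2 - X p.2 p.1)].
have gE (l i : 'I_r) : (l < i)%N -> g [set l; i]%SET = - (X l i - X i l).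
  move=> li; rewrite ffunE (big_pred1 (l, i)) // => -[p q] /=.
  apply/andP/eqP => [[pq /eqP E]|[-> ->]]; last by rewrite eqxx.
  exact/esym/(set2_lt_inj li pq E).
have g2 : g \in koszul_deg 2.
  apply/koszul_degP => S S2; rewrite ffunE big_pred0 ?oppr0 // => -[p q] /=.
  apply: contraNF S2 => /andP[pq /eqP ->]; rewrite cards2.
  by rewrite -val_eqE /= neq_ltn pq.
exists g => //; apply/ffunP => S; have [S1|S1] := eqVneq #|S| 1%N; last first.
  rewrite (iffLR (koszul_degP _ _) x1 _ S1).
  by rewrite (iffLR (koszul_degP _ _) (koszul_diff_deg a g2) _ S1).
have /cards1P[l ->] : #|S| == 1%N by apply/eqP.
have -> : x [set l]%SET = koszul_col x l 0 by rewrite mxE.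
rewrite xX mxE koszul_diff_set1 [RHS]big_mkcond /=; apply: eq_bigr => i _.
rewrite !mxE -val_eqE /=; case: ltngtP => [il|li|/val_inj->] /=.
- by rewrite finset.setUC gE // expr1 mulN1r mulrN mulNr opprK mulrC.
- by rewrite gE // expr0 mul1r mulrC opprB.
- by rewrite subrr mul0r.
Qed.

End KoszulColumns.

(** * Koszul homology modulo a regular sequence *)

Section Split.
Context {R : comNzRingType} {d k : nat} (z : d.-tuple R) (w : 'I_k -> R).
Hypothesis zreg : regular_sequence z.
Local Notation J := (ideal_gen z).
Local Notation zeta := (\col_i z`_i : 'cV[R]_d).
Local Notation omega := (\col_j w j : 'cV[R]_k).

Lemma dot_col n (a : 'I_n -> R) (v : 'cV[R]_n) :
  (\col_i a i)^T *m v = (\sum_i v i 0 * a i)%:M.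
Proof.
apply/matrixP => i j; rewrite !ord1 !mxE eqxx mulr1n; apply: eq_bigr => l _.
by rewrite !mxE mulrC.
Qed.

Lemma scalar_mx11_eq0 (a : R) : a%:M = 0 :> 'M_1 -> a = 0.
Proof. by move=> /(congr1 (fun M : 'M_1 => M 0 0)); rewrite !mxE eqxx mulr1n. Qed.

(* For a regular sequence z, H_1(z, w; R) is H_1(w; R / (z)).                  *)
Lemma ilen_koszul_mod_regular h : ilen (koszul_syz J w) (syz J w) h ->
  ilen (boundaries_col (col_mx zeta omega)) (cycles_col (col_mx zeta omega)) h.
Proof.
have Jgens := gens_seq (a := z) (A := J) (fun _ => erefl).
pose f (v : 'cV[R]_(d + k)) : {ffun 'I_k -> R^o} := [ffun j => v (rshift d j) 0].
have fE v : \sum_j (f v j : R) * w j = \sum_j dsubmx v j 0 * w j.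
  by apply: eq_bigr => j _; rewrite ffunE mxE.
have cycE v : v \in cycles_col (col_mx zeta omega) ->
    \sum_i usubmx v i 0 * z`_i + \sum_j dsubmx v j 0 * w j = 0.
  move=> /propsubP; rewrite -[v in _ *m v]vsubmxK tr_col_mx mul_row_col !dot_col.
  by rewrite -raddfD => /scalar_mx11_eq0.
apply: (ilen_pull (f := f)).
- by move=> c v v'; apply/ffunP => j; rewrite !ffunE !mxE.
- exact: boundaries_cycles_col.
- exact: koszul_syz_sub.
- move=> v /cycE /eqP; rewrite addrC addr_eq0 => /eqP vE; apply/propsubP.
  rewrite fE vE; apply: idealN; apply/Jgens; by exists (fun i => usubmx v i 0).
- move=> q /propsubP /Jgens[c cE].
  exists (col_mx (\col_i - c i) (\col_j (q j : R))); last first.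
    have -> : f (col_mx (\col_i - c i) (\col_j (q j : R))) = q.
      by apply/ffunP => j; rewrite ffunE col_mxEd mxE.
    by rewrite subrr rpred0.
  apply/propsubP; rewrite tr_col_mx mul_row_col !dot_col -raddfD /=.
  have -> : \sum_j (\col_j (q j : R)) j 0 * w j = \sum_j (q j : R) * w j.
    by apply: eq_bigr => j _; rewrite mxE.
  rewrite cE -big_split big1 ?raddf0 // => i _ /=.
  by rewrite mxE mulNr addNr.
move=> v vZ; apply/idP/idP => [/propsubP[Y YP]|/propsubP[X vX]]; apply/propsubP; last first.
  exists (fun i j => X (rshift d i) (rshift d j)) => i.
  rewrite ffunE vX mxE big_split_ord /= /skew_sum.
  have -> : \sum_(j < k) (X - X^T) (rshift d i) (rshift d j) * col_mx zeta omega (rshift d j) 0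
      = \sum_j (X (rshift d i) (rshift d j) - X (rshift d j) (rshift d i)) * w j.
    by apply: eq_bigr => j _; rewrite col_mxEd !mxE.
  rewrite addrK; apply/Jgens; exists (fun j => (X - X^T) (rshift d i) (lshift k j)).
  by apply: eq_bigr => j _; rewrite col_mxEu [in X in _ * X]mxE.
have /choice[M ME] i : exists c : 'I_d -> R,
    (f v i : R) - skew_sum Y w i = \sum_j c j * z`_j by apply/Jgens.
pose MM : 'M[R]_(k, d) := \matrix_(i, j) M i j.
pose YY : 'M[R]_k := \matrix_(i, j) Y i j.
have vd : dsubmx v = MM *m zeta + (YY - YY^T) *m omega.
  apply/matrixP => i j; rewrite ord1 [RHS]mxE.
  have -> : ((YY - YY^T) *m omega) i 0 = skew_sum Y w i.
    by rewrite mxE; apply: eq_bigr => l _; rewrite !mxE.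
  have -> : (MM *m zeta) i 0 = \sum_j M i j * z`_j.
    by rewrite mxE; apply: eq_bigr => l _; rewrite !mxE.
  by rewrite -ME subrK ffunE mxE.
(* By [vd] the cycle condition makes [usubmx v + MM^T *m omega] a syzygy of [z], hence the trivial
   one given by [W]; the block matrix below reassembles [v]. *)
have [|W WE] := @regular_syzygies _ d z (usubmx v + MM^T *m omega) zreg.
  have /propsubP := vZ; rewrite -[v in _ *m v]vsubmxK tr_col_mx mul_row_col vd.
  rewrite !mulmxDr skew_form0 addr0 => H.
  by rewrite -[X in _ + X = _]tr_mx11 !trmx_mul !trmxK -mulmxA.
exists (block_mx W 0 MM YY); rewrite tr_block_mx opp_block_mx add_block_mx.
rewrite mul_block_col -WE -[LHS]vsubmxK vd trmx0 subr0 sub0r mulNmx addrK.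
by [].
Qed.

End Split.

(** * The minimal generators [z, w] of [I_2] and the length formula *)

Theorem theorem3p7 (R : comNzRingType) (m : ideal R) (d s : nat)
    (z : d.-tuple R) :
  gorenstein_local m -> krull_dim R d -> (2 <= d)%N -> (2 <= s)%N ->
  regular_sequence z -> {subset z <= ideal_exp m s} ->
  let J := ideal_gen z in
  let I (k : nat) := ideal_colon J (ideal_exp m k) in
  (exists w : seq R, minimal_generators (I 2%N) (z ++ w)) ->
  forall (r : nat) (a : r.-tuple R), minimal_generators (I 2%N) a ->
  let n := length (subquotient m (ideal_exp m 2)) in
  [/\ finite_length (koszul_homology a 1),
      finite_length (quotient (I 2%N)),
      finite_length (quotient (ideal_exp m 2)),
      finite_length (subquotient m (ideal_exp m 2)) &
      (length (koszul_homology a 1))%:Z =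
        n%:Z * (length (quotient (I 2%N)))%:Z + 'C(n.+1, 2)%:Z
        - (length (quotient (ideal_exp m 2)))%:Z].
Proof.
move=> Gor dimR d2 s2 zreg zms J I [w0 zw0] r a amin n.
have [noe loc _] := Gor.
have primeJ P : prime_ideal P -> {subset J <= P} -> {subset m <= P}.
  exact: prime_over_parameters.
have Jm2 : {subset J <= ideal_exp m 2}.
  by apply: ideal_gen_sub => x /zms; apply: ideal_exp_anti.
have Jinj := gorenstein_self_injective Gor dimR zreg.
have [k [x [gx mx]]] := min_gens_exists noe loc m.
have k2 := embedding_dim_ge2 noe loc dimR d2 gx.
have [u [w db]] := dual_basis_exists noe loc primeJ Jm2 Jinj gx mx.
have [_ mu xw wI I2gen] := db.
have Jgens := gens_seq (a := z) (A := J) (fun _ => erefl).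
have JI : {subset J <= I 2%N} by exact: JI2.
pose b : 'cV[R]_(d + k) := col_mx (\col_i z`_i) (\col_j w j).
have bsum (c : 'I_(d + k) -> R) : \sum_i c i * b i 0 =
    \sum_(i < d) c (lshift k i) * z`_i + \sum_(j < k) c (rshift d j) * w j.
  rewrite big_split_ord; congr (_ + _); apply: eq_bigr => i _.
    by rewrite col_mxEu mxE.
  by rewrite col_mxEd mxE.
have gb : gens (fun i => b i 0) (I 2%N).
  move=> v; split=> [/I2gen[c [e vE]]|[c ->]]; last first.
    rewrite bsum; apply: idealD; apply: ideal_sum => i _; apply: idealM; last exact: wI.
    by apply/JI/ideal_gen_mem/mem_nth; rewrite size_tuple.
  (* The socle generator [u] is absorbed as [x o * w o] modulo [J]. *)
  pose o := Ordinal (ltnW k2).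
  have : v - \sum_j (c j + (j == o)%:R * (e * x o)) * w j \in J.
    under eq_bigr do rewrite mulrDl -mulrA; rewrite big_split /=.
    rewrite (sum_delta (fun j => e * x o * w j)).
    have -> : v - (\sum_j c j * w j + e * x o * w o) =
      (v - \sum_j c j * w j - e * u) - e * (x o * w o - (o == o)%:R * u).
      by rewrite eqxx mul1r; ring.
    by apply: (@idealB _ J); [|apply: (@idealM _ J)].
  move=> /Jgens[c' vE'].
  exists (fun i => match split i with inl i' => c' i' | inr j =>
    c j + (j == o)%:R * (e * x o) end).
  rewrite bsum; apply/eqP; rewrite -subr_eq; apply/eqP.
  transitivity (\sum_i c' i * z`_i); last first.
    by apply: eq_bigr => i _; rewrite -[lshift k i]/(unsplit (inl i)) unsplitK.
  rewrite -vE'; congr (_ - _); apply: eq_bigr => j _.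
  by rewrite -[rshift d j]/(unsplit (inr j)) unsplitK.
have mb : minrel m (fun i => b i 0).
  move=> c; rewrite bsum => c0.
  (* Duality puts the coefficients of [w] in [m]. Rewriting the relation in the minimal generators
     [z ++ w0] then changes those of [z] only by elements of [m]. *)
  have cw : forall j, c (rshift d j) \in m.
    apply: (dual_basis_indep noe loc gx db); apply: JU.
    move/eqP: c0; rewrite addrC addr_eq0 => /eqP ->; apply: idealN; apply/Jgens.
    by exists (fun i => c (lshift k i)).
  have gzw : gens (fun i : 'I_(d + size w0) => (cat_tuple z (in_tuple w0))`_i) (I 2%N).
    by apply: gens_seq; exact: zw0.1.
  have mzw := minimal_generators_minrel noe loc (a := cat_tuple z (in_tuple w0)) zw0.
  have /choice[e eE] j : exists e : 'I_(d + size w0) -> R,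
      w j = \sum_i e i * (cat_tuple z (in_tuple w0))`_i by apply/gzw/wI.
  pose c' (i : 'I_(d + size w0)) : R :=
    (if split i is inl i' then c (lshift k i') else 0) + \sum_j c (rshift d j) * e j i.
  have c'0 : \sum_i c' i * (cat_tuple z (in_tuple w0))`_i = 0.
    under eq_bigr do rewrite mulrDl; rewrite big_split /= -[RHS]c0; congr (_ + _).
      rewrite big_split_ord /= [X in _ + X]big1 ?addr0 => [|j _].
        apply: eq_bigr => i _; rewrite -[lshift _ i]/(unsplit (inl i)) unsplitK /=.
        by rewrite nth_cat size_tuple ltn_ord.
      by rewrite -[rshift _ j]/(unsplit (inr j)) unsplitK mul0r.
    under eq_bigr do rewrite mulr_suml; rewrite exchange_big /=.
    apply: eq_bigr => j _; rewrite eE mulr_sumr; apply: eq_bigr => i _.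
    by rewrite mulrA.
  move=> i; case: (splitP i) => [i' ii'|j ij]; last first.
    by have -> : i = rshift d j by apply: val_inj.
  have -> : i = lshift k i' by apply: val_inj.
  have := mzw c' c'0 (lshift _ i'); rewrite /c' -[lshift (size w0) i']/(unsplit (inl i')) unsplitK.
  move=> H; rewrite -(addrK (\sum_j c (rshift d j) * e j (unsplit (inl i'))) (c _)).
  by apply: idealB => //; apply: ideal_sum => j _; exact: idealMC.
have ga : gens (fun i => tuple_col a i 0) (I 2%N).
  move=> v; apply: (iff_trans (gens_seq amin.1 v)).
  by split=> -[c ->]; exists c; apply: eq_bigr => i _; rewrite mxE.
have ma : minrel m (fun i => tuple_col a i 0).
  move=> c c0; apply: (minimal_generators_minrel noe loc amin (c := c)).
  by rewrite -[RHS]c0; apply: eq_bigr => i _; rewrite mxE.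
have [P [L [LP PL bP]]] := gens_change noe loc ga ma gb mb.
have [l0 Jl0] := finite_colength noe loc primeJ.
have [l Il] := ilen_sub JI (fun v _ => in_top v) (fun v _ => in_top v) Jl0.
have [h Bh hE] := ilen_koszul_syz noe loc gx db k2 Il.
have Hh : is_length (koszul_homology a 1) h.
  apply/ilen_koszul1; apply: (ilen_change_gens LP PL bP).
  exact: ilen_koszul_mod_regular.
have HI : is_length (quotient (I 2%N)) l by apply/is_length_quotient.
have Hm2 : is_length (quotient (ideal_exp m 2)) k.+1.
  by apply/is_length_quotient; exact: (ilen_m2_top loc gx mx).
have Hm : is_length (subquotient m (ideal_exp m 2)) k.
  by apply/(is_length_subquotient _ (@exp2_sub _ m)); exact: (ilen_m2_m loc gx mx).
split; try by [exists h | exists l | exists k.+1 | exists k].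
rewrite /n (lengthE Hh) (lengthE HI) (lengthE Hm2) (lengthE Hm).
move: hE; rewrite -[in X in _ -> X]PoszM -PoszD; move=> hE.
(* This is [hE] rewritten with [k.+1 * k = 2 * 'C(k.+1, 2)]. *)
rewrite [in RHS](_ : (k * l + 'C(k.+1, 2) = h + k.+1)%N); last first.
  have := mul_bin_diag k.+1 1; rewrite bin1 => E.
  by nia.
by rewrite PoszD addrK.
Qed.
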